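(* Let $f\in\mathcal{S}_S^*$, i.e. $f$ is starlike with respect to symmetric points in the unit disk $\mathbb{D}$, and let $\gamma_n$ ($n\ge 1$) be the logarithmic coefficients of $f$. Then the second Hankel determinant of logarithmic coefficients $H_{2,1}(F_f/2)=\gamma_1\gamma_3-\gamma_2^2$ satisfies $$|H_{2,1}(F_f/2)|\le \frac14 .$$ The inequality is sharp, i.e. there exists $f\in\mathcal{S}_S^*$ for which equality holds.
   Context: Let $\mathbb{D}=\{z\in\mathbb{C}:|z|<1\}$. Let $\mathcal{A}$ be the class of analytic functions $f:\mathbb{D}\to\mathbb{C}$ with $f(0)=0$ and $f'(0)=1$, written $f(z)=z+\sum_{n=2}^\infty a_nz^n$, and let $\mathcal{S}\subset\mathcal{A}$ be the subclass of univalent (one-to-one) functions. The class $\mathcal{S}_S^*$ of functions starlike with respect to symmetric points consists of all $f\in\mathcal{A}$ such that $$\mathrm{Re}\left(\frac{zf'(z)}{f(z)-f(-z)}\right)>0,\qquad z\in\mathbb{D},$$ where the quotient is understood as an analytic function on $\mathbb{D}$ with its limiting value $1/2$ at $z=0$. Such functions are known to be univalent, so $\mathcal{S}_S^*\subset\mathcal{S}$. The logarithmic coefficients $\gamma_n$ of $f$ are defined by $$F_f(z):=\log\frac{f(z)}{z}=2\sum_{n=1}^\infty\gamma_nz^n,$$ where $f(z)/z$ is given the value $1$ at $z=0$ and the branch of the logarithm is the one with $\log 1=0$. Equivalently, $\gamma_1=\frac12a_2$, $\gamma_2=\frac12\left(a_3-\frac12a_2^2\right)$, $\gamma_3=\frac12\left(a_4-a_2a_3+\frac13a_2^3\right)$.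 The second Hankel determinant of $F_f/2$ is $$H_{2,1}(F_f/2)=\begin{vmatrix}\gamma_1&\gamma_2\\ \gamma_2&\gamma_3\end{vmatrix}=\gamma_1\gamma_3-\gamma_2^2 .$$ *)

(* Defs.v *)
From Stdlib Require Import Reals.
From Coquelicot Require Import Coquelicot.

Local Open Scope C_scope.

Definition in_disk (z : C) : Prop := (Cmod z < 1)%R.

(* Functions on the disk are total functions [C -> C]; only their values on
   the disk are ever constrained.  Analyticity is complex differentiability at
   every point of the open disk. *)
Definition analytic_on_disk (f : C -> C) : Prop :=
  forall z : C, in_disk z ->
    ex_derive (K := C_AbsRing) (V := C_NormedModule) f z.

Definition class_A (f : C -> C) : Prop :=
  analytic_on_disk f /\ f 0 = 0 /\ C_derive f 0 = 1.

(* z f'(z) / (f(z) - f(-z)), completed by its limiting value at the origin. *)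
Definition symmetric_quotient (f : C -> C) (z : C) : C :=
  if Ceq_dec z 0 then 1 / 2
  else z * C_derive f z / (f z - f (- z)).

(* The condition f(z) <> f(-z) makes explicit that the quotient is defined on
   the punctured disk: division by zero is total here.  It is not an extra
   restriction: if the quotient q merely extended analytically across a zero
   z0 <> 0 of h(z) = f(z) - f(-z), then z h'(z) = (q(z) + q(-z)) h(z), so h
   would vanish identically, contradicting h'(0) = 2. *)
Definition starlike_symmetric (f : C -> C) : Prop :=
  class_A f /\
  forall z : C, in_disk z ->
    (z <> 0 -> f z <> f (- z)) /\ (0 < Re (symmetric_quotient f z))%R.

Definition Cexp (z : C) : C :=
  RtoC (exp (Re z)) * (cos (Im z), sin (Im z)).

Definition quotient_by_id (f : C -> C) (z : C) : C :=
  if Ceq_dec z 0 then 1 else f z / z.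

(* F is the analytic branch of log (f(z)/z) on the disk with F(0) = log 1 = 0;
   these conditions determine F on the disk. *)
Definition is_log_quotient (f F : C -> C) : Prop :=
  analytic_on_disk F /\ F 0 = 0 /\
  forall z : C, in_disk z -> Cexp (F z) = quotient_by_id f z.

(* F(z) = 2 * sum_(n >= 1) gamma_n z^n on the disk; gamma_0 is irrelevant. *)
Definition log_coefficients (f : C -> C) (gamma : nat -> C) : Prop :=
  exists F : C -> C,
    is_log_quotient f F /\
    forall z : C, in_disk z ->
      is_series (K := C_AbsRing) (V := C_NormedModule)
        (fun n : nat => 2 * (gamma (S n) * z ^ S n)) (F z).

Definition det2 (a b c d : C) : C := a * d - b * c.

Definition hankel_2_1 (gamma : nat -> C) : C :=
  det2 (gamma 1%nat) (gamma 2%nat)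
       (gamma 2%nat) (gamma 3%nat).

(* Main.v *)
Require Import Defs.
From Stdlib Require Import Reals Lra Lia.
From Coquelicot Require Import Coquelicot.

(* With F = log (f(z)/z), u = 1 + z F'(z) and v = (1 + exp (F(-z) - F(z))) / 2
   the quotient z f'(z) / (f(z) - f(-z)) equals u / (2 v), so that
   w = (u - v) / (u + v) maps the disk into itself and vanishes at 0.  For
   w = b1 z + b2 z^2 + b3 z^3 + ... , comparing coefficients gives
   b1 = 2 gamma_1, b2 = 2 (gamma_2 - gamma_1^2),
   b3 = 4 (gamma_3 - gamma_1 gamma_2 - gamma_1^3 / 3), hence
     8 (gamma_1 gamma_3 - gamma_2^2) = b1 b3 - b1^2 b2 + b1^4 / 6 - 2 b2^2.
   The Bessel inequality |b1|^2 + |b2|^2 + |b3|^2 <= 1 alone bounds the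
   right-hand side by 2.  Bessel's inequality follows from the mean value
   property, which for functions with a continuous complex derivative is
   differentiation under the integral sign.  Equality holds for w = z^2, that is
   f(z) = z / (1 - z^2). *)

Local Open Scope C_scope.

(** * Continuity and complex derivatives *)

(* [C_UniformSpace] has square balls; this uniform structure has round ones, so
   that the generic lemmas on [AbsRing]s apply to it. *)
Notation CU := (AbsRing_UniformSpace C_AbsRing).
Notation ccont f x := (@continuous _ CU f x).

(** Differentiation under the integral sign needs a continuous complex derivative, while analyticity
    here is mere differentiability at each point; the general passage from one to the other is
    Goursat's theorem. It is avoided because the logarithmic coefficients present F as a convergent
    power series: F' and F'' come from termwise differentiation, and f = z exp F, u, v and w are
    built from F, F' and the exponential. No power series is constructed for w. Its coefficients
    come from expansions to third order whose remainder is continuous at 0. Bessel's inequality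
    divides by z repeatedly, so it is phrased for functions that are differentiable off 0 and have a
    limit at 0. The final estimate is tight only in b2: the terms other than -2 b2^2 cost at most
    (5/3)|b1|^2 + |b3|^2 / 2, with both factors below 2. Hence three terms of Bessel suffice, and
    equality forces |b2| = 1. *)

Lemma ccont_eps (f : C -> C) (z : C) :
  @continuous CU CU f z <->
  (forall eps : R, (0 < eps)%R -> exists d : R, (0 < d)%R /\
     forall w : C, (Cmod (w - z) < d)%R -> (Cmod (f w - f z) < eps)%R).
Proof.
  split.
  - intros H eps He.
    destruct (proj1 (filterlim_locally (U := CU) f (f z)) H (mkposreal eps He))
      as [d Hd].
    exists d. split; [apply cond_pos|]. intros w Hw. exact (Hd w Hw).
  - intros H. apply (proj2 (filterlim_locally (U := CU) f (f z))).
    intros eps. destruct (H eps (cond_pos eps)) as [d [Hd H']].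
    exists (mkposreal d Hd). intros w Hw. exact (H' w Hw).
Qed.

Lemma ccont_const {T : UniformSpace} (c : C) (x : T) : ccont (fun _ => c) x.
Proof. apply continuous_const. Qed.

Lemma ccont_id (z : C) : @continuous CU CU (fun w => w) z.
Proof. exact (continuous_id (U := CU) z). Qed.

Lemma ccont_plus {T : UniformSpace} (f g : T -> C) (x : T) :
  ccont f x -> ccont g x -> ccont (fun y => f y + g y) x.
Proof.
  intros Hf Hg.
  exact (continuous_plus (V := AbsRing_NormedModule C_AbsRing) f g x Hf Hg).
Qed.

Lemma ccont_mult {T : UniformSpace} (f g : T -> C) (x : T) :
  ccont f x -> ccont g x -> ccont (fun y => f y * g y) x.
Proof.
  intros Hf Hg. exact (continuous_mult (K := C_AbsRing) f g x Hf Hg).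
Qed.

Lemma ccont_opp {T : UniformSpace} (f : T -> C) (x : T) :
  ccont f x -> ccont (fun y => - f y) x.
Proof.
  intros Hf.
  exact (continuous_opp (V := AbsRing_NormedModule C_AbsRing) f x Hf).
Qed.

Lemma ccont_minus {T : UniformSpace} (f g : T -> C) (x : T) :
  ccont f x -> ccont g x -> ccont (fun y => f y - g y) x.
Proof. intros Hf Hg. apply ccont_plus; [|apply ccont_opp]; assumption. Qed.

Lemma Cmod_triangle_rev (a b : C) : (Cmod a - Cmod b <= Cmod (a - b))%R.
Proof.
  pose proof (Cmod_triangle (a - b) b) as H.
  replace (a - b + b) with a in H by ring. lra.
Qed.

Lemma Cinv_cont (z : C) : z <> 0 -> @continuous CU CU Cinv z.
Proof.
  intros Hz. apply ccont_eps. intros eps He.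
  assert (Hm : (0 < Cmod z)%R) by now apply Cmod_gt_0.
  set (m := Cmod z) in *.
  (* The first radius keeps |w| > m/2, so that |1/w - 1/z| = |w - z| / (|w| m) is at most |w - z| /
     (m^2 / 2); the second makes this less than [eps]. *)
  exists (Rmin (m / 2) (eps * (m * m) / 2)). split.
  { apply Rmin_glb_lt; [lra|]. apply Rdiv_lt_0_compat; [|lra].
    apply Rmult_lt_0_compat; [lra|]. nra. }
  intros w Hw.
  pose proof (Rlt_le_trans _ _ _ Hw (Rmin_l _ _)) as H1.
  pose proof (Rlt_le_trans _ _ _ Hw (Rmin_r _ _)) as H2.
  assert (Hwm : (m / 2 < Cmod w)%R).
  { pose proof (Cmod_triangle_rev z w) as H. fold m in H.
    replace (z - w) with (- (w - z)) in H by ring. rewrite Cmod_opp in H. lra. }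
  assert (Hw0 : w <> 0) by (apply Cmod_gt_0; lra).
  replace (/ w - / z) with (- (w - z) / (w * z)) by (field; auto).
  rewrite Cmod_div by now apply Cmult_neq_0.
  rewrite Cmod_opp, Cmod_mult. fold m.
  apply Rlt_div_l; [nra|].
  assert (0 < eps * m)%R by nra. nra.
Qed.

Lemma ccont_inv {T : UniformSpace} (f : T -> C) (x : T) :
  ccont f x -> f x <> 0 -> ccont (fun y => / f y) x.
Proof.
  intros Hf H0. apply (continuous_comp (U := T) (V := CU) (W := CU) f Cinv);
    [exact Hf|]. now apply Cinv_cont.
Qed.

Lemma ccont_div {T : UniformSpace} (f g : T -> C) (x : T) :
  ccont f x -> ccont g x -> g x <> 0 -> ccont (fun y => f y / g y) x.
Proof. intros Hf Hg H0. apply ccont_mult; [|apply ccont_inv]; assumption. Qed.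

(* The domain is passed explicitly: unification would otherwise read the
   domain [C] as [C_UniformSpace]. *)
Ltac ccont :=
  repeat first
    [ assumption
    | lazymatch goal with
      | |- @continuous ?T _ (fun _ => ?c) _ => apply (@ccont_const T)
      | |- @continuous _ _ (fun y => y) _ => apply ccont_id
      | |- @continuous ?T _ (fun y => _ + _) _ => apply (@ccont_plus T)
      | |- @continuous ?T _ (fun y => _ - _) _ => apply (@ccont_minus T)
      | |- @continuous ?T _ (fun y => - _) _ => apply (@ccont_opp T)
      | |- @continuous ?T _ (fun y => _ * _) _ => apply (@ccont_mult T)
      | |- @continuous ?T _ (fun y => _ / _) _ => apply (@ccont_div T)
      | |- @continuous ?T _ (fun y => / _) _ => apply (@ccont_inv T)
      end ].

Lemma ccont_comp {T : UniformSpace} (f : T -> C) (g : C -> C) (x : T) :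
  ccont f x -> @continuous CU CU g (f x) -> ccont (fun y => g (f y)) x.
Proof. apply (continuous_comp (U := T) (V := CU) (W := CU) f g). Qed.

Lemma ccont_pair {T : UniformSpace} (f g : T -> R) (x : T) :
  continuous f x -> continuous g x -> ccont (fun y => (f y, g y)) x.
Proof.
  intros Hf Hg. apply (proj2 (filterlim_locally (U := CU) _ _)). intros eps.
  assert (He : (0 < eps / 2)%R) by (pose proof (cond_pos eps); lra).
  pose proof (proj1 (filterlim_locally f (f x)) Hf (mkposreal _ He)) as H1.
  pose proof (proj1 (filterlim_locally g (g x)) Hg (mkposreal _ He)) as H2.
  generalize (filter_and _ _ H1 H2). apply filter_imp. intros y [B1 B2].
  change (Cmod ((f y, g y) - (f x, g x)) < eps)%R.
  replace ((f y, g y) - (f x, g x))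
    with (RtoC (f y - f x) + Ci * RtoC (g y - g x))
    by (apply injective_projections; simpl; ring).
  eapply Rle_lt_trans; [apply Cmod_triangle|].
  rewrite Cmod_mult, Cmod_Ci, 2!Cmod_R.
  change (Rabs (f y - f x) < eps / 2)%R in B1.
  change (Rabs (g y - g x) < eps / 2)%R in B2. lra.
Qed.

Lemma Re_cont (z : C) : @continuous CU R_UniformSpace Re z.
Proof.
  apply (proj2 (filterlim_locally Re (Re z))). intros eps.
  exists eps. intros w Hw. change (Rabs (Re w - Re z) < eps)%R.
  eapply Rle_lt_trans; [|exact Hw].
  change (Rabs (Re w - Re z) <= Cmod (w - z))%R.
  replace (Re w - Re z)%R with (Re (w - z)) by (unfold Re; simpl; ring).
  apply re_le_Cmod.
Qed.

Lemma Re_ccont {T : UniformSpace} (f : T -> C) (x : T) :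
  ccont f x -> continuous (fun y => Re (f y)) x.
Proof.
  intros Hf. apply (continuous_comp (V := CU) f Re); [exact Hf|apply Re_cont].
Qed.

(* Caratheodory's form of the derivative: algebraic rules for derivatives
   become continuity statements. *)
Definition cdiff (f : C -> C) (z l : C) : Prop :=
  exists phi : C -> C,
    @continuous CU CU phi z /\ phi z = l /\
    forall w, f w = f z + (w - z) * phi w.

Lemma cdiff_ccont (f : C -> C) (z l : C) :
  cdiff f z l -> @continuous CU CU f z.
Proof.
  intros [phi [Hc [_ Hf]]].
  apply (continuous_ext (T := CU) (U := CU)) with (f := fun w => f z + (w - z) * phi w).
  { intros w. symmetry. apply Hf. }
  ccont.
Qed.

(** [cdiff] asks for a factorization on the whole plane, but a local one suffices: the difference
    quotient factors [f] everywhere and agrees with [phi] near [z]. *)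
Lemma cdiff_intro (f phi : C -> C) (z l : C) :
  @continuous CU CU phi z -> phi z = l ->
  locally (T := CU) z (fun w => f w = f z + (w - z) * phi w) -> cdiff f z l.
Proof.
  intros Hc Hl [d Hd].
  set (psi := fun w => if Ceq_dec w z then l else (f w - f z) / (w - z)).
  assert (Hpsi : psi z = l) by (unfold psi; destruct (Ceq_dec z z); congruence).
  exists psi. split; [|split; [exact Hpsi|]].
  - apply (continuous_ext_loc (T := CU) (U := CU)) with (g := phi); [|exact Hc].
    exists d. intros w Hw. change (phi w = psi w). unfold psi.
    destruct (Ceq_dec w z) as [->|Hn].
    + exact Hl.
    + rewrite (Hd w Hw). field. intros H. apply Hn.
      replace w with (w - z + z) by ring. rewrite H. ring.
  - intros w. unfold psi. destruct (Ceq_dec w z) as [->|Hn].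
    + ring.
    + field. intros H. apply Hn.
      replace w with (w - z + z) by ring. rewrite H. ring.
Qed.

Lemma cdiff_ext_loc (f g : C -> C) (z l : C) :
  locally (T := CU) z (fun w => f w = g w) -> cdiff f z l -> cdiff g z l.
Proof.
  intros Hl [phi [Hc [Hp Hf]]].
  apply cdiff_intro with phi; [exact Hc|exact Hp|].
  pose proof (locally_singleton _ _ Hl) as Hz. simpl in Hz.
  revert Hl. apply filter_imp. intros w <-. rewrite <- Hz. apply Hf.
Qed.

Lemma cdiff_eq (f : C -> C) (z l l' : C) : l = l' -> cdiff f z l -> cdiff f z l'.
Proof. now intros <-. Qed.

Lemma cdiff_const (c z : C) : cdiff (fun _ => c) z 0.
Proof.
  exists (fun _ => 0). split; [ccont|split; [reflexivity|]].
  intros; ring.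
Qed.

Lemma cdiff_id (z : C) : cdiff (fun w => w) z 1.
Proof.
  exists (fun _ => 1). split; [ccont|split; [reflexivity|]].
  intros; ring.
Qed.

Lemma cdiff_plus (f g : C -> C) (z l m : C) :
  cdiff f z l -> cdiff g z m -> cdiff (fun w => f w + g w) z (l + m).
Proof.
  intros [p [Hp [Hpl Hf]]] [q [Hq [Hql Hg]]].
  exists (fun w => p w + q w). split; [ccont|split; [congruence|]].
  intros w. rewrite (Hf w), (Hg w). ring.
Qed.

Lemma cdiff_mult (f g : C -> C) (z l m : C) :
  cdiff f z l -> cdiff g z m ->
  cdiff (fun w => f w * g w) z (l * g z + f z * m).
Proof.
  intros Hf0 Hg0. pose proof (cdiff_ccont _ _ _ Hg0) as Hgc.
  destruct Hf0 as [p [Hp [Hpl Hf]]], Hg0 as [q [Hq [Hql Hg]]].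
  exists (fun w => p w * g w + f z * q w). split; [|split; [congruence|]].
  - ccont.
  - intros w. rewrite (Hf w), (Hg w). ring.
Qed.

Lemma cdiff_comp (f g : C -> C) (z l m : C) :
  cdiff f z l -> cdiff g (f z) m -> cdiff (fun w => g (f w)) z (m * l).
Proof.
  intros Hf0 [q [Hq [Hql Hg]]]. pose proof (cdiff_ccont _ _ _ Hf0) as Hfc.
  destruct Hf0 as [p [Hp [Hpl Hf]]].
  exists (fun w => q (f w) * p w). split; [|split; [congruence|]].
  - ccont. now apply (@ccont_comp CU).
  - intros w. rewrite (Hg (f w)). rewrite (Hf w) at 1. ring.
Qed.

Lemma Cinv_cdiff (z : C) : z <> 0 -> cdiff Cinv z (- / (z * z)).
Proof.
  intros Hz.
  apply cdiff_intro with (fun w => - / (w * z)).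
  - ccont. now apply Cmult_neq_0.
  - reflexivity.
  - assert (Hm : (0 < Cmod z)%R) by now apply Cmod_gt_0.
    exists (mkposreal _ Hm). intros w Hw.
    assert (Hw0 : (w : C) <> 0).
    { intros ->. change (Cmod (0 - z) < Cmod z)%R in Hw.
      replace (0 - z) with (- z) in Hw by ring. rewrite Cmod_opp in Hw. lra. }
    field. auto.
Qed.

Lemma cdiff_div (f g : C -> C) (z l m : C) :
  cdiff f z l -> cdiff g z m -> g z <> 0 ->
  cdiff (fun w => f w / g w) z ((l * g z - f z * m) / (g z * g z)).
Proof.
  intros Hf Hg H0.
  eapply cdiff_eq; [|apply cdiff_mult;
    [exact Hf|apply (cdiff_comp g Cinv); [exact Hg|now apply Cinv_cdiff]]].
  cbv beta. field. exact H0.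
Qed.

Lemma cdiff_is_derive (f : C -> C) (z l : C) :
  cdiff f z l <-> is_derive (K := C_AbsRing) (V := C_NormedModule) f z l.
Proof.
  split.
  - intros [phi [Hc [Hl Hf]]]. split; [apply is_linear_scal_l|].
    intros z' Hz'.
    pose proof (is_filter_lim_locally_unique
      (V := AbsRing_NormedModule C_AbsRing) z z' Hz') as E.
    change (z = z' :> C) in E. subst z'.
    intros eps.
    destruct (proj1 (ccont_eps phi z) Hc eps (cond_pos eps)) as [d [Hd H]].
    exists (mkposreal d Hd). intros w Hw. specialize (H w Hw).
    change (Cmod (f w - f z - (w - z) * l) <= eps * Cmod (w - z))%R.
    rewrite (Hf w), <- Hl.
    replace (f z + (w - z) * phi w - f z - (w - z) * phi z)
      with ((phi w - phi z) * (w - z)) by ring.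
    rewrite Cmod_mult. apply Rmult_le_compat_r; [apply Cmod_ge_0|lra].
  - intros [_ H].
    specialize (H z (fun P HP => HP)).
    set (psi := fun w => if Ceq_dec w z then l else (f w - f z) / (w - z)).
    assert (Hpsi : psi z = l)
      by (unfold psi; destruct (Ceq_dec z z); congruence).
    assert (Hne : forall w, w <> z -> w - z <> 0).
    { intros w Hn E. apply Hn. replace w with (w - z + z) by ring.
      rewrite E. ring. }
    exists psi. split; [|split; [exact Hpsi|]].
    + apply ccont_eps. intros eps He.
      assert (He2 : (0 < eps / 2)%R) by lra.
      destruct (H (mkposreal _ He2)) as [d Hd].
      exists d. split; [apply cond_pos|]. intros w Hw. rewrite Hpsi.
      unfold psi. destruct (Ceq_dec w z) as [->|Hn].
      { replace (l - l) with (RtoC 0) by ring. rewrite Cmod_0. exact He. }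
      specialize (Hd w Hw).
      change (Cmod (f w - f z - (w - z) * l) <= eps / 2 * Cmod (w - z))%R in Hd.
      pose proof (Hne w Hn) as Hn'.
      replace ((f w - f z) / (w - z) - l)
        with ((f w - f z - (w - z) * l) / (w - z)) by (field; exact Hn').
      rewrite Cmod_div by exact Hn'.
      pose proof (proj1 (Cmod_gt_0 _) Hn') as Hp.
      apply Rle_lt_trans with (eps / 2)%R; [|lra].
      apply Rle_div_l; [exact Hp|exact Hd].
    + intros w. unfold psi. destruct (Ceq_dec w z) as [->|Hn].
      * ring.
      * field. now apply Hne.
Qed.

(** * Complex power series *)

Lemma cdiff_of_quadratic (f : C -> C) (z l : C) (K d : R) :
  (0 < d)%R -> (0 <= K)%R ->
  (forall w, (Cmod (w - z) < d)%R ->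
     (Cmod (f w - f z - (w - z) * l) <= K * (Cmod (w - z) * Cmod (w - z)))%R) ->
  cdiff f z l.
Proof.
  intros Hd HK H. apply cdiff_is_derive. split; [apply is_linear_scal_l|].
  intros z' Hz'.
  pose proof (is_filter_lim_locally_unique
    (V := AbsRing_NormedModule C_AbsRing) z z' Hz') as E.
  change (z = z' :> C) in E. subst z'.
  intros eps. pose proof (cond_pos eps) as He.
  (* [K + 1] rather than [K] covers the case [K = 0]. *)
  assert (Hm : (0 < Rmin d (eps / (K + 1)))%R).
  { apply Rmin_glb_lt; [exact Hd|]. apply Rdiv_lt_0_compat; lra. }
  exists (mkposreal _ Hm). intros w Hw.
  change (Cmod (w - z) < Rmin d (eps / (K + 1)))%R in Hw.
  change (Cmod (f w - f z - (w - z) * l) <= eps * Cmod (w - z))%R.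
  pose proof (Rlt_le_trans _ _ _ Hw (Rmin_l _ _)) as H1.
  pose proof (Rlt_le_trans _ _ _ Hw (Rmin_r _ _)) as H2.
  apply Rlt_div_r in H2; [|lra].
  eapply Rle_trans; [apply (H w H1)|].
  pose proof (Cmod_ge_0 (w - z)). nra.
Qed.

Notation cseries a l := (is_series (K := C_AbsRing) (V := C_NormedModule) a l).

Lemma cseries_ext (a b : nat -> C) (l : C) :
  (forall n, a n = b n) -> cseries a l -> cseries b l.
Proof. apply (is_series_ext (V := C_NormedModule)). Qed.

Lemma cseries_plus (a b : nat -> C) (l m : C) :
  cseries a l -> cseries b m -> cseries (fun n => a n + b n) (l + m).
Proof. apply (is_series_plus (V := C_NormedModule)). Qed.

Lemma cseries_scal (c : C) (a : nat -> C) (l : C) :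
  cseries a l -> cseries (fun n => c * a n) (c * l).
Proof. apply (is_series_scal (V := C_NormedModule)). Qed.

Lemma cseries_minus (a b : nat -> C) (l m : C) :
  cseries a l -> cseries b m -> cseries (fun n => a n - b n) (l - m).
Proof.
  intros Ha Hb.
  replace (l - m) with (l + (- (1)) * m) by ring.
  apply cseries_ext with (fun n => a n + (- (1)) * b n); [intros; ring|].
  apply cseries_plus; [exact Ha|]. now apply cseries_scal.
Qed.

Lemma cseries_shift (a : nat -> C) (l : C) :
  cseries a l <-> cseries (fun n => a (S n)) (l - a 0%nat).
Proof.
  split; intros H.
  - apply (is_series_incr_1 (V := C_NormedModule)).
    change (cseries a (l - a 0%nat + a 0%nat)).
    replace (l - a 0%nat + a 0%nat) with l by ring. exact H.
  - apply (is_series_decr_1 (V := C_NormedModule)). exact H.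
Qed.

Lemma cseries_unique (a : nat -> C) (l m : C) :
  cseries a l -> cseries a m -> l = m.
Proof.
  apply (filterlim_locally_unique (V := C_NormedModule) (F := eventually)).
Qed.

Lemma cseries_norm_le (a : nat -> C) (b : nat -> R) (l : C) (s : R) :
  (forall n, (Cmod (a n) <= b n)%R) -> cseries a l -> is_series b s ->
  (Cmod l <= s)%R.
Proof.
  intros Hab Ha Hb.
  change (Rbar_le (Finite (Cmod l)) (Finite s)).
  apply (filterlim_le (F := eventually))
    with (f := fun n => norm (sum_n (G := C_NormedModule) a n)) (g := sum_n b).
  - exists 0%nat. intros n _.
    eapply Rle_trans; [apply (norm_sum_n_m (V := C_NormedModule))|].
    apply sum_n_m_le. exact Hab.
  - exact (filterlim_comp _ _ _ _ _ _ _ _ Ha (filterlim_norm (V := C_NormedModule) l)).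
  - exact Hb.
Qed.

Definition power_series_on_disk (a : nat -> C) (f : C -> C) : Prop :=
  forall z, in_disk z -> cseries (fun n => a n * z ^ n) (f z).

Lemma cseries_terms_bounded (a : nat -> C) (l : C) :
  cseries a l -> exists M : R, forall n, (Cmod (a n) <= M)%R.
Proof.
  intros H.
  destruct (filterlim_bounded (V := C_NormedModule)
    (sum_n (G := C_NormedModule) a) (ex_intro _ l H)) as [M HM].
  assert (HM' : forall n, (Cmod (sum_n (G := C_NormedModule) a n) <= M)%R)
    by exact HM.
  (* A term is a difference of consecutive partial sums, each bounded by [M]. *)
  exists (2 * M)%R. intros [|n].
  - specialize (HM' 0%nat). rewrite sum_O in HM'.
    pose proof (Cmod_ge_0 (a 0%nat)). lra.
  - pose proof (HM' n) as H1. pose proof (HM' (S n)) as H2.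
    rewrite sum_Sn in H2.
    change (Cmod (sum_n (G := C_NormedModule) a n + a (S n)) <= M)%R in H2.
    set (s := sum_n (G := C_NormedModule) a n : C) in *.
    pose proof (Cmod_triangle_rev (s + a (S n)) s) as H3.
    pose proof (Cmod_triangle (s + a (S n)) (- s)) as H4.
    rewrite Cmod_opp in H4.
    replace (s + a (S n) + - s) with (a (S n)) in H4 by ring. lra.
Qed.

(** Taking moduli of the coefficients hands convergence over to real power series. Convergence at a
    real point r < 1 bounds |a_n| r^n, so every such r is at most the radius. *)
Lemma power_series_CV_radius (a : nat -> C) (f : C -> C) :
  power_series_on_disk a f -> Rbar_le 1 (CV_radius (fun n => Cmod (a n))).
Proof.
  intros H.
  assert (Hr : forall r : R, (0 <= r < 1)%R ->
            Rbar_le r (CV_radius (fun n => Cmod (a n)))).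
  { intros r Hr. apply (proj1 (CV_radius_bounded _)).
    assert (Hd : in_disk (RtoC r))
      by (unfold in_disk; rewrite Cmod_R, Rabs_pos_eq; lra).
    destruct (cseries_terms_bounded _ _ (H _ Hd)) as [M HM].
    exists M. intros n. specialize (HM n).
    rewrite Cmod_mult, Cmod_pow, Cmod_R, (Rabs_pos_eq r) in HM by lra.
    rewrite Rabs_pos_eq; [exact HM|].
    apply Rmult_le_pos; [apply Cmod_ge_0|apply pow_le; lra]. }
  pose proof (CV_radius_ge_0 (fun n => Cmod (a n))) as H0.
  destruct (CV_radius (fun n => Cmod (a n))) as [c| |]; simpl in *; auto.
  destruct (Rle_or_lt 1 c) as [Hc|Hc]; [exact Hc|].
  specialize (Hr ((c + 1) / 2)%R). lra.
Qed.

Lemma CV_radius_inside (A : nat -> R) (r : R) :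
  Rbar_le 1 (CV_radius A) -> (forall n, (0 <= A n)%R) -> (0 <= r < 1)%R ->
  ex_series (fun n => A n * r ^ n)%R.
Proof.
  intros HC HA Hr.
  assert (H : ex_series (fun n => Rabs (A n * r ^ n))).
  { apply CV_disk_inside. apply Rbar_lt_le_trans with (Finite 1); [|exact HC].
    simpl. rewrite Rabs_pos_eq; lra. }
  eapply ex_series_ext; [|exact H].
  intros n. simpl. apply Rabs_pos_eq.
  apply Rmult_le_pos; [apply HA|apply pow_le; lra].
Qed.

(** The induction rests on D_(n+1) = w D_n + (n+2) z^(n+1) (w - z)^2. The factor on the right is the
    n-th term of the second derivative of a power series at r, which makes these bounds summable. *)
Lemma pow_second_difference (z w : C) (r : R) (n : nat) :
  (Cmod z <= r)%R -> (Cmod w <= r)%R ->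
  (Cmod (w ^ S (S n) - z ^ S (S n) - INR (S (S n)) * z ^ S n * (w - z)) <=
   INR (S (S n)) * INR (S n) * r ^ n * (Cmod (w - z) * Cmod (w - z)))%R.
Proof.
  intros Hz Hw. pose proof (Cmod_ge_0 z) as H0.
  set (e := (Cmod (w - z) * Cmod (w - z))%R).
  assert (He : (0 <= e)%R)
    by (unfold e; pose proof (Cmod_ge_0 (w - z)); nra).
  induction n as [|n IH].
  - simpl. replace (w * (w * 1) - z * (z * 1) - RtoC (1 + 1) * (z * 1) * (w - z))
      with ((w - z) * (w - z)).
    + rewrite Cmod_mult. fold e. lra.
    + rewrite RtoC_plus. ring.
  - set (D := w ^ S (S n) - z ^ S (S n) - INR (S (S n)) * z ^ S n * (w - z)) in *.
    replace (w ^ S (S (S n)) - z ^ S (S (S n)) -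
             INR (S (S (S n))) * z ^ S (S n) * (w - z))
      with (w * D + INR (S (S n)) * z ^ S n * ((w - z) * (w - z))).
    2: { unfold D. rewrite (S_INR (S (S n))), RtoC_plus.
         rewrite !(Cpow_S _ (S _)). ring. }
    eapply Rle_trans; [apply Cmod_triangle|].
    rewrite !Cmod_mult. fold e. rewrite Cmod_R, Cmod_pow.
    rewrite (Rabs_pos_eq (INR _)) by apply pos_INR.
    assert (Hp : (Cmod z ^ S n <= r ^ S n)%R) by (apply pow_incr; lra).
    assert (Hr : (0 <= r ^ n)%R) by (apply pow_le; lra).
    rewrite (S_INR (S (S n))), (S_INR (S n)) in *.
    pose proof (pos_INR (S n)) as Hn. set (N := INR (S n)) in *.
    assert (H1 : (Cmod w * Cmod D <= r * ((N + 1) * N * r ^ n * e))%R).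
    { apply Rmult_le_compat; auto using Cmod_ge_0. }
    assert (H2 : ((N + 1) * Cmod z ^ S n * e <= (N + 1) * (r * r ^ n) * e)%R).
    { apply Rmult_le_compat_r; [exact He|].
      apply Rmult_le_compat_l; [lra|exact Hp]. }
    assert (H3 : (0 <= (N + 1) * (r * r ^ n) * e)%R).
    { apply Rmult_le_pos; [|exact He]. apply Rmult_le_pos; [lra|].
      apply Rmult_le_pos; lra. }
    simpl (r ^ S n)%R. nra.
Qed.

(** Chosen by definite description, hence meaningful only when the series converges. *)
Definition Csum (a : nat -> C) : C :=
  @iota C_CompleteNormedModule (fun l => cseries a l).

Lemma Csum_correct (a : nat -> C) :
  ex_series (K := C_AbsRing) (V := C_NormedModule) a -> cseries a (Csum a).
Proof.
  intros [l Hl].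
  apply (iota_correct (V := C_CompleteNormedModule) (fun l => cseries a l)).
  exists l. split; [exact Hl|]. intros m Hm. exact (cseries_unique a l m Hl Hm).
Qed.

(** The series of moduli has radius at least 1, and so have its first two derivatives. The first
    dominates the derived series; the second, taken at a radius r strictly between |z| and 1, bounds
    the first-order Taylor remainder by a multiple of |w - z|^2. *)
Lemma power_series_derive (a : nat -> C) (f : C -> C) :
  power_series_on_disk a f ->
  exists f' : C -> C,
    power_series_on_disk (fun n => INR (S n) * a (S n)) f' /\
    forall z, in_disk z -> cdiff f z (f' z).
Proof.
  intros Hf. pose proof (power_series_CV_radius a f Hf) as HC.
  set (A := fun n => Cmod (a n)) in *.
  assert (HA : forall n, (0 <= A n)%R) by (intros; apply Cmod_ge_0).
  assert (HA1 : forall n, (0 <= PS_derive A n)%R)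
    by (intros; apply Rmult_le_pos; [apply pos_INR|apply HA]).
  assert (HA2 : forall n, (0 <= PS_derive (PS_derive A) n)%R)
    by (intros; apply Rmult_le_pos; [apply pos_INR|apply HA1]).
  set (f' := fun z => Csum (fun n => INR (S n) * a (S n) * z ^ n)).
  assert (Hf' : power_series_on_disk (fun n => INR (S n) * a (S n)) f').
  { intros z Hz. apply Csum_correct.
    apply (ex_series_le (V := C_CompleteNormedModule))
      with (fun n => PS_derive A n * Cmod z ^ n)%R.
    - intros n.
      change (Cmod (INR (S n) * a (S n) * z ^ n) <= PS_derive A n * Cmod z ^ n)%R.
      rewrite !Cmod_mult, Cmod_pow, Cmod_R, Rabs_pos_eq by apply pos_INR.
      apply Rle_refl.
    - apply CV_radius_inside; [now rewrite CV_radius_derive|exact HA1|].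
      split; [apply Cmod_ge_0|exact Hz]. }
  exists f'. split; [exact Hf'|]. intros z Hz. unfold in_disk in Hz.
  set (r := ((1 + Cmod z) / 2)%R). pose proof (Cmod_ge_0 z) as Hz0.
  destruct (CV_radius_inside (PS_derive (PS_derive A)) r) as [s Hs].
  { now rewrite !CV_radius_derive. }
  { exact HA2. }
  { unfold r. lra. }
  assert (Hd : (0 < (1 - Cmod z) / 2)%R) by lra.
  (* The zero series, with sum 0, is compared with the nonnegative series of sum [s]. *)
  assert (Hs0 : (0 <= s)%R).
  { apply (cseries_norm_le (fun _ => 0) _ 0 s) in Hs.
    - now rewrite Cmod_0 in Hs.
    - intros n. rewrite Cmod_0. apply Rmult_le_pos; [apply HA2|].
      apply pow_le. unfold r. lra.
    - replace (RtoC 0) with (0 * f z) by ring.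
      apply cseries_ext with (fun n => 0 * (a n * z ^ n)); [intros; ring|].
      apply cseries_scal, Hf. exact Hz. }
  apply cdiff_of_quadratic with s ((1 - Cmod z) / 2)%R; [exact Hd|exact Hs0|].
  intros w Hw.
  assert (Hwr : (Cmod w <= r)%R).
  { pose proof (Cmod_triangle_rev w z). unfold r. lra. }
  assert (Hzr : (Cmod z <= r)%R) by (unfold r; lra).
  assert (Hwd : in_disk w) by (unfold in_disk; unfold r in Hwr; lra).
  pose proof (proj1 (cseries_shift _ _) (Hf w Hwd)) as S1.
  pose proof (proj1 (cseries_shift _ _) (Hf z Hz)) as S2.
  pose proof (cseries_scal (w - z) _ _ (Hf' z Hz)) as S3.
  pose proof (cseries_minus _ _ _ _ (cseries_minus _ _ _ _ S1 S2) S3) as S4.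
  (* The term of index 0 is a_1 w - a_1 z - (w - z) a_1 = 0. Dropping it keeps the sum and leaves
     the terms that [pow_second_difference] estimates. *)
  apply (fun H => proj1 (cseries_shift _ _) H) in S4. cbv beta in S4.
  match type of S4 with is_series _ ?l =>
    replace l with (f w - f z - (w - z) * f' z) in S4 end.
  2: { simpl. ring. }
  rewrite (Rmult_comm s).
  refine (cseries_norm_le _ _ _ _ _ S4
    (is_series_scal (V := R_NormedModule) (Cmod (w - z) * Cmod (w - z))%R _ _ Hs)).
  intros n.
  match goal with |- (Cmod ?x <= _)%R =>
    replace x with (a (S (S n)) *
      (w ^ S (S n) - z ^ S (S n) - INR (S (S n)) * z ^ S n * (w - z))) by ring end.
  rewrite Cmod_mult.
  eapply Rle_trans.
  { apply Rmult_le_compat_l; [apply Cmod_ge_0|].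
    apply (pow_second_difference z w r n Hzr Hwr). }
  unfold PS_derive, A, scal; simpl. unfold mult; simpl. apply Req_le. ring.
Qed.

Lemma power_series_at_0 (a : nat -> C) (f : C -> C) :
  power_series_on_disk a f -> f 0 = a 0%nat.
Proof.
  intros Hf. assert (H0 : in_disk 0) by (unfold in_disk; rewrite Cmod_0; lra).
  pose proof (proj1 (cseries_shift _ _) (Hf 0 H0)) as H.
  (* At the origin all terms of the shifted series vanish, so scaling by 0 does not change them;
     uniqueness of the sum l then gives l = 0 * l. *)
  assert (E : f 0 - a 0%nat * 0 ^ 0 = 0 * (f 0 - a 0%nat * 0 ^ 0)).
  { eapply cseries_unique; [exact H|].
    eapply cseries_ext; [|apply cseries_scal; exact H].
    intros n. simpl. ring. }
  replace (f 0) with (f 0 - a 0%nat * 0 ^ 0 + a 0%nat) by (simpl; ring).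
  rewrite E. ring.
Qed.

Lemma power_series_tail (a : nat -> C) (f : C -> C) :
  power_series_on_disk a f ->
  exists g : C -> C,
    power_series_on_disk (fun n => a (S n)) g /\
    forall z, in_disk z -> f z = a 0%nat + z * g z.
Proof.
  intros Hf.
  (* At 0 the tail series has the sum a_1, since z ^ 0 = 1 there too. *)
  exists (fun z => if Ceq_dec z 0 then a 1%nat else (f z - a 0%nat) / z).
  split.
  - intros z Hz. destruct (Ceq_dec z 0) as [->|Hn].
    + apply cseries_shift.
      replace (a 1%nat - a 1%nat * 0 ^ 0) with (0 * f 0) by (simpl; ring).
      eapply cseries_ext; [|apply cseries_scal, (Hf 0 Hz)].
      intros n. simpl. ring.
    + pose proof (proj1 (cseries_shift _ _) (Hf z Hz)) as H.
      replace ((f z - a 0%nat) / z) with (/ z * (f z - a 0%nat * z ^ 0))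
        by (simpl; field; exact Hn).
      eapply cseries_ext; [|apply cseries_scal, H].
      intros n. simpl. field. exact Hn.
  - intros z Hz. destruct (Ceq_dec z 0) as [->|Hn].
    + rewrite (power_series_at_0 a f Hf). ring.
    + field. exact Hn.
Qed.

(** * The complex exponential *)

Lemma Cexp_plus (z w : C) : Cexp (z + w) = Cexp z * Cexp w.
Proof.
  destruct z as [a b], w as [c d]. unfold Cexp; simpl.
  rewrite exp_plus, cos_plus, sin_plus.
  apply injective_projections; simpl; ring.
Qed.

Lemma Cexp_0 : Cexp 0 = 1.
Proof.
  unfold Cexp; simpl. rewrite exp_0, cos_0, sin_0.
  apply injective_projections; simpl; ring.
Qed.

Lemma Cexp_opp_r (z : C) : Cexp z * Cexp (- z) = 1.
Proof.
  rewrite <- Cexp_plus. replace (z + - z) with (RtoC 0) by ring. apply Cexp_0.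
Qed.

Lemma Cexp_neq_0 (z : C) : Cexp z <> 0.
Proof.
  intros E. pose proof (Cexp_opp_r z) as H. rewrite E in H.
  apply (f_equal fst) in H. simpl in H. lra.
Qed.

Lemma Cmod_Cexp (z : C) : Cmod (Cexp z) = exp (Re z).
Proof.
  unfold Cexp. rewrite Cmod_mult, Cmod_R.
  rewrite Rabs_pos_eq by (apply Rlt_le, exp_pos).
  replace (Cmod (cos (Im z), sin (Im z))) with 1%R; [ring|].
  unfold Cmod; simpl. symmetry. transitivity (sqrt 1); [|apply sqrt_1].
  f_equal. pose proof (sin2_cos2 (Im z)) as H. unfold Rsqr, Im in *. lra.
Qed.

Lemma is_derive_Cexp_ray (c w : C) (t : R) :
  is_derive (fun t : R => Re (c * Cexp (t * w))) t
    (Re (c * w * Cexp (t * w))).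
Proof.
  destruct c as [a b], w as [x y].
  apply is_derive_ext with
    (fun t => exp (t * x) * (a * cos (t * y) - b * sin (t * y)))%R.
  { intros s. unfold Cexp; simpl.
    replace (s * x - 0 * y)%R with (s * x)%R by ring.
    replace (s * y + 0 * x)%R with (s * y)%R by ring. ring. }
  unfold Cexp; simpl.
  replace (t * x - 0 * y)%R with (t * x)%R by ring.
  replace (t * y + 0 * x)%R with (t * y)%R by ring.
  auto_derive; [easy|]. ring.
Qed.

Lemma is_derive_n_Cexp_ray (c w : C) (n : nat) (t : R) :
  is_derive_n (fun t : R => Re (c * Cexp (t * w))) n t
    (Re (c * w ^ n * Cexp (t * w))).
Proof.
  revert t. induction n as [|n IH]; intros t.
  - replace (c * w ^ 0) with c by (change (w ^ 0) with (RtoC 1); ring).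
    reflexivity.
  - apply is_derive_ext with (fun t : R => Re (c * w ^ n * Cexp (t * w))).
    + intros s. symmetry. apply is_derive_n_unique, IH.
    + replace (c * w ^ S n) with (c * w ^ n * w) by (simpl; ring).
      apply is_derive_Cexp_ray.
Qed.

(** Lagrange's remainder exists only for real functions, so Taylor's formula is applied to t |-> Re
    (c exp (t w)) on [0, 1], each derivative of which multiplies c by w. The free factor [c] later
    recovers the modulus. The polynomial is in Horner form. *)
Lemma Cexp_taylor_Re (c w : C) :
  exists s : R, (0 < s < 1)%R /\
    (Re (c * (Cexp w - (1 + w * (1 + w * (1 / 2 + w * (1 / 6)))))) =
     / 24 * Re (c * w ^ 4 * Cexp (s * w)))%R.
Proof.
  destruct (Taylor_Lagrange (fun t : R => Re (c * Cexp (t * w))) 3 0 1)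
    as [s [Hs E]]; [lra| |].
  { intros t _ k _. destruct k as [|k]; [exact I|].
    eexists. apply (is_derive_n_Cexp_ray c w (S k) t). }
  exists s. split; [exact Hs|].
  cbn [sum_f_R0] in E.
  rewrite !(is_derive_n_unique _ _ _ _ (is_derive_n_Cexp_ray c w _ _)) in E.
  replace (RtoC 1 * w) with w in E by ring.
  replace (RtoC 0 * w) with (RtoC 0) in E by ring.
  rewrite Cexp_0 in E.
  replace (Re (c * (Cexp w - (1 + w * (1 + w * (1 / 2 + w * (1 / 6)))))))
    with (Re (c * Cexp w) - (Re (c * w ^ 0 * 1) + Re (c * w ^ 1 * 1)
      + / 2 * Re (c * w ^ 2 * 1) + / 6 * Re (c * w ^ 3 * 1)))%R.
  2: { generalize (Cexp w). intros e.
       destruct c as [a b], w as [x y], e as [p q]. unfold Re; simpl. field. }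
  rewrite E. simpl Factorial.fact. cbn [INR]. field.
Qed.

Lemma Cexp_taylor (w : C) :
  (Cmod w <= 1)%R ->
  (Cmod (Cexp w - (1 + w * (1 + w * (1 / 2 + w * (1 / 6))))) <= Cmod w ^ 4)%R.
Proof.
  intros Hw.
  set (D := Cexp w - (1 + w * (1 + w * (1 / 2 + w * (1 / 6))))).
  (* This choice turns Re (c D) into |D|^2. Since exp (Re (s w)) <= e <= 3, it follows that |D|^2 <=
     (3/24) |D| |w|^4, and one factor |D| cancels. *)
  set (c := Cconj D).
  destruct (Cexp_taylor_Re c w) as [s [Hs E]]. fold D in E.
  assert (E2 : (Cmod D ^ 2 = / 24 * Re (c * w ^ 4 * Cexp (s * w)))%R).
  { rewrite <- E, Cmod2_alt. unfold c. generalize D. intros [x y].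
    simpl. ring. }
  assert (E3 : (Re (c * w ^ 4 * Cexp (s * w)) <= Cmod D * (Cmod w ^ 4 * 3))%R).
  { eapply Rle_trans; [apply Rle_abs|]. eapply Rle_trans; [apply re_le_Cmod|].
    rewrite !Cmod_mult, Cmod_pow, Cmod_Cexp. unfold c. rewrite Cmod_conj.
    rewrite Rmult_assoc. apply Rmult_le_compat_l; [apply Cmod_ge_0|].
    apply Rmult_le_compat_l; [apply pow_le, Cmod_ge_0|].
    eapply Rle_trans; [|apply exp_le_3].
    assert (Hx : (Re (s * w) <= 1)%R).
    { rewrite re_scal_l.
      pose proof (re_le_Cmod w) as Hr. pose proof (Rle_abs (Re w)). nra. }
    destruct Hx as [Hx| ->]; [left; now apply exp_increasing|apply Rle_refl]. }
  pose proof (Cmod_ge_0 D) as HD.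
  assert (HW : (0 <= Cmod w ^ 4)%R) by apply pow_le, Cmod_ge_0.
  destruct (Rle_lt_or_eq_dec _ _ HD) as [HD'|HD']; [|lra].
  simpl (Cmod D ^ 2)%R in E2. set (W := (Cmod w ^ 4)%R) in *. nra.
Qed.

Lemma Cexp_cdiff_0 : cdiff Cexp 0 1.
Proof.
  apply cdiff_of_quadratic with 3%R 1%R; [lra|lra|].
  intros w Hw. rewrite Cexp_0.
  replace (w - 0) with w in * by ring.
  pose proof (Cexp_taylor w (Rlt_le _ _ Hw)) as H.
  replace (Cexp w - 1 - w * 1) with
    (Cexp w - (1 + w * (1 + w * (1 / 2 + w * (1 / 6)))) +
     w * w * (1 / 2 + w * (1 / 6))) by field.
  eapply Rle_trans; [apply Cmod_triangle|].
  assert (H2 : (Cmod (1 / 2 + w * (1 / 6)) <= 1)%R).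
  { eapply Rle_trans; [apply Cmod_triangle|].
    rewrite Cmod_mult, <- !RtoC_div, !Cmod_R, !Rabs_pos_eq by lra.
    pose proof (Cmod_ge_0 w). lra. }
  rewrite !Cmod_mult. pose proof (Cmod_ge_0 w) as H0.
  assert (Cmod w ^ 4 <= Cmod w * Cmod w)%R.
  { simpl. assert (Cmod w * Cmod w <= 1)%R by nra. nra. }
  nra.
Qed.

Lemma Cexp_cdiff (z : C) : cdiff Cexp z (Cexp z).
Proof.
  apply cdiff_ext_loc with (fun w => Cexp z * Cexp (w + - z)).
  { apply filter_forall. intros w. rewrite <- Cexp_plus. f_equal. ring. }
  eapply cdiff_eq; [|apply cdiff_mult; [apply cdiff_const|]].
  2: { apply (cdiff_comp (fun w => w + - z) Cexp).
       - apply cdiff_plus; [apply cdiff_id|apply cdiff_const].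
       - replace (z + - z) with (RtoC 0) by ring. apply Cexp_cdiff_0. }
  cbv beta. ring.
Qed.

(** * The mean value property *)

Lemma is_derive_caratheodory (x phi : R -> R) (t : R) :
  continuous phi t -> (forall s, x s = (x t + (s - t) * phi s)%R) ->
  is_derive x t (phi t).
Proof.
  intros Hc Hx. split; [apply is_linear_scal_l|].
  intros t' Ht'.
  pose proof (is_filter_lim_locally_unique
    (V := AbsRing_NormedModule R_AbsRing) t t' Ht') as E.
  change (t = t' :> R) in E. subst t'.
  intros eps.
  generalize (proj1 (filterlim_locally phi (phi t)) Hc eps).
  apply filter_imp. intros s Hs.
  change (Rabs (phi s - phi t) < eps)%R in Hs.
  change (Rabs (x s - x t - (s - t) * phi t) <= eps * Rabs (s - t))%R.
  rewrite (Hx s).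
  replace (x t + (s - t) * phi s - x t - (s - t) * phi t)%R
    with ((phi s - phi t) * (s - t))%R by ring.
  rewrite Rabs_mult. apply Rmult_le_compat_r; [apply Rabs_pos|lra].
Qed.

Lemma caratheodory_is_derive (x : R -> R) (t l : R) :
  is_derive x t l ->
  exists phi : R -> R, continuous phi t /\ phi t = l /\
    forall s, x s = (x t + (s - t) * phi s)%R.
Proof.
  intros [_ H]. specialize (H t (fun P HP => HP)).
  set (phi := fun s => if Req_EM_T s t then l else ((x s - x t) / (s - t))%R).
  assert (Hphi : phi t = l)
    by (unfold phi; destruct (Req_EM_T t t); congruence).
  exists phi. split; [|split; [exact Hphi|]].
  - apply (proj2 (filterlim_locally phi (phi t))). intros eps.
    assert (He2 : (0 < eps / 2)%R) by (pose proof (cond_pos eps); lra).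
    generalize (H (mkposreal _ He2)). apply filter_imp. intros s Hs.
    change (Rabs (phi s - phi t) < eps)%R. rewrite Hphi.
    change (Rabs (x s - x t - (s - t) * l) <= eps / 2 * Rabs (s - t))%R in Hs.
    unfold phi. destruct (Req_EM_T s t) as [->|Hn].
    { replace (l - l)%R with 0%R by ring. rewrite Rabs_R0. apply cond_pos. }
    assert (Hn' : (s - t)%R <> 0%R) by lra.
    replace ((x s - x t) / (s - t) - l)%R
      with ((x s - x t - (s - t) * l) / (s - t))%R by (field; exact Hn').
    rewrite Rabs_div by exact Hn'.
    apply Rle_lt_trans with (eps / 2)%R; [|lra].
    apply Rle_div_l; [now apply Rabs_pos_lt|exact Hs].
  - intros s. unfold phi. destruct (Req_EM_T s t) as [->|Hn].
    + ring.
    + field. lra.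
Qed.

(** Caratheodory's form again, for curves in the plane: the chain rule with [cdiff] is then a
    product of continuous factors. *)
Definition path_deriv (g : R -> C) (t : R) (l : C) : Prop :=
  exists psi : R -> C, ccont psi t /\ psi t = l /\
    forall s : R, g s = g t + RtoC (s - t) * psi s.

Lemma path_deriv_ccont (g : R -> C) (t : R) (l : C) :
  path_deriv g t l -> ccont g t.
Proof.
  intros [psi [Hc [_ Hg]]].
  apply (continuous_ext (T := R_UniformSpace) (U := CU))
    with (f := fun s => g t + RtoC (s - t) * psi s).
  { intros s. symmetry. apply Hg. }
  ccont. apply ccont_pair; [|apply continuous_const].
  apply (continuous_minus (V := R_NormedModule)).
  - apply continuous_id.
  - apply continuous_const.
Qed.

Lemma path_deriv_comp (f : C -> C) (g : R -> C) (t : R) (l m : C) :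
  path_deriv g t l -> cdiff f (g t) m -> path_deriv (fun s => f (g s)) t (m * l).
Proof.
  intros Hg0 [q [Hq [Hql Hf]]]. pose proof (path_deriv_ccont _ _ _ Hg0) as Hgc.
  destruct Hg0 as [p [Hp [Hpl Hg]]].
  exists (fun s => q (g s) * p s). split; [|split; [congruence|]].
  - ccont. now apply (@ccont_comp R_UniformSpace).
  - intros s. rewrite (Hf (g s)). rewrite (Hg s) at 1. ring.
Qed.

(** The factor [c] serves two purposes: c = 1 and c = -i recover both coordinates, and c = -i/r
    turns an angular derivative into a radial one. *)
Lemma path_deriv_Re (g : R -> C) (t : R) (c l : C) :
  path_deriv g t l -> is_derive (fun s => Re (c * g s)) t (Re (c * l)).
Proof.
  intros [psi [Hc [Hl Hg]]]. rewrite <- Hl.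
  apply (is_derive_caratheodory (fun s => Re (c * g s)) (fun s => Re (c * psi s))).
  - apply Re_ccont. ccont.
  - intros s. rewrite (Hg s). generalize (g t) (psi s). intros [a b] [p q].
    destruct c as [x y]. unfold Re; simpl. ring.
Qed.

Lemma path_deriv_ray (z : C) (t : R) : path_deriv (fun s => s * z) t z.
Proof.
  exists (fun _ => z). split; [ccont|split; [reflexivity|]].
  intros s. rewrite RtoC_minus. ring.
Qed.

Definition cis (t : R) : C := (cos t, sin t).

Lemma cis_cont (t : R) : ccont cis t.
Proof. apply ccont_pair; [apply continuous_cos|apply continuous_sin]. Qed.

Lemma ccont_cis_snd (p : R * R) : ccont (fun p : R * R => cis (snd p)) p.
Proof.
  apply (continuous_comp (V := R_UniformSpace) (W := CU) snd cis).
  - apply (continuous_snd (U := R_UniformSpace) (V := R_UniformSpace)).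
  - apply cis_cont.
Qed.

Lemma ccont_polar (p : R * R) : ccont (fun p : R * R => fst p * cis (snd p)) p.
Proof.
  apply ccont_mult; [|apply ccont_cis_snd].
  apply ccont_pair; [|apply continuous_const].
  apply (continuous_fst (U := R_UniformSpace) (V := R_UniformSpace)).
Qed.

Lemma Cmod_cis (t : R) : Cmod (cis t) = 1%R.
Proof.
  unfold Cmod, cis; simpl. transitivity (sqrt 1); [|apply sqrt_1].
  f_equal. pose proof (sin2_cos2 t) as H. unfold Rsqr in *. lra.
Qed.

Lemma Cmod_circle (r t : R) : (0 <= r)%R -> Cmod (r * cis t) = r.
Proof.
  intros Hr. rewrite Cmod_mult, Cmod_cis, Cmod_R, Rabs_pos_eq by exact Hr. ring.
Qed.

Lemma path_deriv_circle (r t : R) :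
  path_deriv (fun s => r * cis s) t (r * (Ci * cis t)).
Proof.
  destruct (caratheodory_is_derive cos t (- sin t)) as [p [Hp [Ep Hcos]]].
  { auto_derive; [easy|ring]. }
  destruct (caratheodory_is_derive sin t (cos t)) as [q [Hq [Eq Hsin]]].
  { auto_derive; [easy|ring]. }
  exists (fun s => r * (p s, q s)). split; [|split].
  - ccont. now apply ccont_pair.
  - rewrite Ep, Eq. unfold cis. apply injective_projections; simpl; ring.
  - intros s. unfold cis. rewrite (Hcos s), (Hsin s).
    apply injective_projections; simpl; ring.
Qed.

Lemma cdiff_zero_constant (f : C -> C) :
  (forall z, in_disk z -> cdiff f z 0) -> forall z, in_disk z -> f z = f 0.
Proof.
  intros Hf z Hz. unfold in_disk in Hz.
  assert (H : forall c, Re (c * f z) = Re (c * f 0)).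
  { intros c.
    pose proof (eq_is_derive (fun s : R => Re (c * f (s * z))) 0 1) as H.
    cbv beta in H.
    replace (RtoC 0 * z) with (RtoC 0) in H by ring.
    replace (RtoC 1 * z) with z in H by ring.
    symmetry. apply H; [|lra]. intros t Ht.
    change (is_derive (fun s : R => Re (c * f (s * z))) t 0%R).
    replace 0%R with (Re (c * (0 * z))).
    2: { replace (c * (0 * z)) with (RtoC 0) by ring. reflexivity. }
    apply (path_deriv_Re (fun s : R => f (s * z))).
    apply path_deriv_comp with (g := fun s : R => s * z); [apply path_deriv_ray|].
    apply Hf. unfold in_disk. rewrite Cmod_mult, Cmod_R, Rabs_pos_eq by lra.
    pose proof (Cmod_ge_0 z). nra. }
  apply injective_projections.
  - pose proof (H 1) as E. rewrite !Cmult_1_l in E. exact E.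
  - pose proof (H (- Ci)) as E. unfold Re in E. simpl in E. lra.
Qed.

(** The origin is left out because quotients such as w(z)/z carry a default value there; their
    behaviour at 0 is recorded by a limit instead. *)
Definition punctured_disk (z : C) : Prop := (0 < Cmod z < 1)%R.

Definition C1_on (U : C -> Prop) (h : C -> C) : Prop :=
  exists h' : C -> C, forall z, U z -> cdiff h z (h' z) /\ @continuous CU CU h' z.

Lemma C1_on_ccont (U : C -> Prop) (h : C -> C) (z : C) :
  C1_on U h -> U z -> @continuous CU CU h z.
Proof. intros [h' H] Hz. exact (cdiff_ccont _ _ _ (proj1 (H z Hz))). Qed.

Lemma C1_on_sub (U V : C -> Prop) (h : C -> C) :
  (forall z, V z -> U z) -> C1_on U h -> C1_on V h.
Proof. intros HUV [h' H]. exists h'. auto. Qed.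

Lemma C1_on_const (U : C -> Prop) (c : C) : C1_on U (fun _ => c).
Proof.
  exists (fun _ => 0). intros z _. split; [apply cdiff_const|ccont].
Qed.

Lemma C1_on_id (U : C -> Prop) : C1_on U (fun z => z).
Proof.
  exists (fun _ => 1). intros z _. split; [apply cdiff_id|ccont].
Qed.

Lemma C1_on_plus (U : C -> Prop) (f g : C -> C) :
  C1_on U f -> C1_on U g -> C1_on U (fun z => f z + g z).
Proof.
  intros [f' Hf] [g' Hg]. exists (fun z => f' z + g' z). intros z Hz.
  destruct (Hf z Hz), (Hg z Hz). split; [now apply cdiff_plus|ccont].
Qed.

Lemma C1_on_mult (U : C -> Prop) (f g : C -> C) :
  C1_on U f -> C1_on U g -> C1_on U (fun z => f z * g z).
Proof.
  intros HF HG. pose proof (C1_on_ccont U f) as Cf.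
  pose proof (C1_on_ccont U g) as Cg.
  pose proof HF as [f' Hf]. pose proof HG as [g' Hg].
  exists (fun z => f' z * g z + f z * g' z). intros z Hz.
  destruct (Hf z Hz), (Hg z Hz). specialize (Cf z HF Hz). specialize (Cg z HG Hz).
  split; [now apply cdiff_mult|ccont].
Qed.

Lemma C1_on_minus (U : C -> Prop) (f g : C -> C) :
  C1_on U f -> C1_on U g -> C1_on U (fun z => f z - g z).
Proof.
  intros HF [g' Hg]. apply C1_on_plus; [exact HF|].
  exists (fun z => - g' z). intros z Hz. destruct (Hg z Hz) as [H1 H2].
  split; [|ccont].
  apply cdiff_ext_loc with (fun w => - (1) * g w).
  { apply filter_forall. intros w. change (- (1) * g w = - g w). ring. }
  eapply cdiff_eq; [|apply cdiff_mult; [apply cdiff_const|exact H1]]. cbv beta. ring.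
Qed.

Lemma C1_on_div (U : C -> Prop) (f g : C -> C) :
  C1_on U f -> C1_on U g -> (forall z, U z -> g z <> 0) ->
  C1_on U (fun z => f z / g z).
Proof.
  intros HF HG H0. pose proof (C1_on_ccont U f) as Cf.
  pose proof (C1_on_ccont U g) as Cg.
  pose proof HF as [f' Hf]. pose proof HG as [g' Hg].
  exists (fun z => (f' z * g z - f z * g' z) / (g z * g z)). intros z Hz.
  destruct (Hf z Hz), (Hg z Hz). specialize (Cf z HF Hz). specialize (Cg z HG Hz).
  pose proof (H0 z Hz). split; [now apply cdiff_div|ccont].
  now apply Cmult_neq_0.
Qed.

(** * Integrals over circles and the mean value property *)

Definition circle_integral (u : C -> R) (r : R) : R :=
  RInt (fun t => u (r * cis t)) 0 (2 * PI).

Lemma two_PI_pos : (0 < 2 * PI)%R.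
Proof. pose proof PI_RGT_0. lra. Qed.

Lemma circle_punctured (r t : R) :
  (0 < r < 1)%R -> punctured_disk (r * cis t).
Proof. intros Hr. unfold punctured_disk. rewrite Cmod_circle; lra. Qed.

Lemma circle_integrable (u : C -> R) (r : R) :
  (0 < r < 1)%R ->
  (forall z, punctured_disk z -> @continuous CU R_UniformSpace u z) ->
  ex_RInt (fun t => u (r * cis t)) 0 (2 * PI).
Proof.
  intros Hr Hu. apply (ex_RInt_continuous (V := R_CompleteNormedModule)).
  intros t _.
  apply (continuous_comp (U := R_UniformSpace) (V := CU)
           (fun t => r * cis t) u).
  - exact (path_deriv_ccont _ _ _ (path_deriv_circle r t)).
  - now apply Hu, circle_punctured.
Qed.

(** Continuity of h' serves twice: to differentiate under the integral sign, and to integrate the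
    angular derivative by the fundamental theorem of calculus. *)
Lemma circle_integral_is_derive (h : C -> C) (r : R) :
  C1_on punctured_disk h -> (0 < r < 1)%R ->
  is_derive (circle_integral (fun z => Re (h z))) r 0%R.
Proof.
  intros HC Hr. pose proof HC as [h' Hh].
  assert (Hloc : locally r (fun u : R => (0 < u < 1)%R)).
  { apply filter_and; [now apply (open_gt 0)|now apply (open_lt 1)]. }
  assert (Hder : forall u t : R, (0 < u < 1)%R ->
    is_derive (fun v : R => Re (h (v * cis t))) u (Re (h' (u * cis t) * cis t))).
  { intros u t Hu.
    apply is_derive_ext with (fun v : R => Re (1 * h (v * cis t))).
    { intros v. f_equal. ring. }
    replace (h' (u * cis t) * cis t) with (1 * (h' (u * cis t) * cis t)) by ring.
    apply (path_deriv_Re (fun v : R => h (v * cis t))).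
    apply path_deriv_comp with (g := fun v : R => v * cis t).
    - apply path_deriv_ray.
    - apply Hh. now apply circle_punctured. }
  assert (Hcirc : forall x : R, x * cis (2 * PI) = x * cis 0).
  { intros x. unfold cis. rewrite sin_2PI, cos_2PI, sin_0, cos_0. reflexivity. }
  replace 0%R with
    (RInt (fun t => Derive (fun u : R => Re (h (u * cis t))) r) 0 (2 * PI)).
  { apply (is_derive_RInt_param (fun u t => Re (h (u * cis t)))).
    - revert Hloc. apply filter_imp. intros u Hu t _.
      eexists. now apply Hder.
    - intros t _.
      apply continuity_2d_pt_ext_loc
        with (fun u v : R => Re (h' (u * cis v) * cis v)).
      + destruct Hloc as [d Hd]. exists d. intros u v Hu _.
        symmetry. apply is_derive_unique, Hder, Hd, Hu.
      + assert (Hc : ccont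
          (fun p : R * R => h' (fst p * cis (snd p)) * cis (snd p)) (r, t)).
        { apply ccont_mult; [|apply ccont_cis_snd].
          apply (ccont_comp (fun p : R * R => fst p * cis (snd p)) h').
          - apply ccont_polar.
          - apply Hh. now apply circle_punctured. }
        apply continuity_2d_pt_filterlim.
        exact (Re_ccont _ _ Hc).
    - revert Hloc. apply filter_imp. intros u Hu.
      apply (circle_integrable (fun z => Re (h z))); [exact Hu|].
      intros z Hz. apply (Re_ccont (T := CU) h). now apply (C1_on_ccont punctured_disk). }
  transitivity (RInt (fun t => Re (h' (r * cis t) * cis t)) 0 (2 * PI)).
  { apply RInt_ext. intros t _. apply is_derive_unique. now apply Hder. }
  (* Up to the factor [i r], the radial derivative of [h] is the angular one,
     whose integral over a full turn vanishes. *)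
  apply is_RInt_unique.
  assert (E : minus (Re (- Ci / r * h (r * cis (2 * PI))))
                    (Re (- Ci / r * h (r * cis 0))) = 0%R).
  { rewrite Hcirc. unfold minus, plus, opp; simpl. ring. }
  pattern 0%R at 2. rewrite <- E.
  apply (is_RInt_derive (V := R_CompleteNormedModule)
           (fun t => Re (- Ci / r * h (r * cis t)))).
  - intros t _.
    replace (h' (r * cis t) * cis t)
      with (- Ci / r * (h' (r * cis t) * (r * (Ci * cis t)))).
    + apply (path_deriv_Re (fun t : R => h (r * cis t))).
      apply path_deriv_comp with (g := fun t : R => r * cis t).
      * apply path_deriv_circle.
      * apply Hh. now apply circle_punctured.
    + assert (Hr0 : RtoC r <> 0) by (intros H0; apply RtoC_inj in H0; lra).
      assert (Ci2 : Ci * Ci = - (1)) by (apply injective_projections; simpl; ring).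
      transitivity (- (Ci * Ci) * (h' (r * cis t) * cis t)).
      * field. exact Hr0.
      * rewrite Ci2. ring.
  - intros t _. apply (Re_ccont (fun t => h' (r * cis t) * cis t)).
    apply (@ccont_mult R_UniformSpace).
    + apply (@ccont_comp R_UniformSpace (fun t => r * cis t) h').
      * exact (path_deriv_ccont _ _ _ (path_deriv_circle r t)).
      * apply Hh. now apply circle_punctured.
    + apply cis_cont.
Qed.

Lemma Rabs_eq_0_of_small (x : R) :
  (forall eps : R, (0 < eps)%R -> (Rabs x <= eps)%R) -> x = 0%R.
Proof.
  intros H. destruct (Req_dec x 0) as [E|E]; [exact E|].
  pose proof (Rabs_pos_lt x E) as Hp. specialize (H (Rabs x / 2)%R). lra.
Qed.

Definition limit_at_0 (h : C -> C) (a : C) : Prop :=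
  forall eps : R, (0 < eps)%R -> exists d : R, (0 < d)%R /\
    forall z, punctured_disk z -> (Cmod z < d)%R -> (Cmod (h z - a) < eps)%R.

Lemma limit_at_0_of_ccont (h k : C -> C) :
  @continuous CU CU k (RtoC 0) -> (forall z, punctured_disk z -> h z = k z) ->
  limit_at_0 h (k 0).
Proof.
  intros Hk Hh eps He.
  destruct (proj1 (ccont_eps k 0) Hk eps He) as [d [Hd H]].
  exists d. split; [exact Hd|]. intros z Hz Hzd. rewrite (Hh z Hz). apply H.
  now replace (z - 0) with z by ring.
Qed.

Lemma circle_integral_constant (h : C -> C) (r s : R) :
  C1_on punctured_disk h -> (0 < r)%R -> (r < s)%R -> (s < 1)%R ->
  circle_integral (fun z => Re (h z)) r = circle_integral (fun z => Re (h z)) s.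
Proof.
  intros Hh Hr Hrs Hs.
  apply (eq_is_derive (V := R_NormedModule)); [|exact Hrs].
  intros t Ht. apply (circle_integral_is_derive h t Hh). lra.
Qed.

Lemma Re_continuous_on_punctured (h : C -> C) :
  C1_on punctured_disk h ->
  forall z, punctured_disk z -> @continuous CU R_UniformSpace (fun z => Re (h z)) z.
Proof.
  intros Hh z Hz. apply (Re_ccont (T := CU) h). now apply (C1_on_ccont punctured_disk).
Qed.

(** The integral does not depend on the radius, and on small circles [h] is uniformly close to [a];
    the value of [h] at 0 never enters. *)
Lemma mean_value (h : C -> C) (a : C) (r : R) :
  C1_on punctured_disk h -> limit_at_0 h a -> (0 < r < 1)%R ->
  circle_integral (fun z => Re (h z)) r = (2 * PI * Re a)%R.
Proof.
  intros Hh Ha Hr. pose proof two_PI_pos as HPI.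
  apply Rminus_diag_uniq, Rabs_eq_0_of_small.
  intros eps He.
  destruct (Ha (eps / (2 * PI))%R) as [d [Hd H]]; [now apply Rdiv_lt_0_compat|].
  set (s := (Rmin d r / 2)%R).
  assert (Hs : (0 < s /\ s < d /\ s < r)%R).
  { assert (0 < Rmin d r)%R by (apply Rmin_glb_lt; lra).
    pose proof (Rmin_l d r). pose proof (Rmin_r d r). unfold s. lra. }
  rewrite <- (circle_integral_constant h s r Hh) by lra.
  assert (Hs1 : (0 < s < 1)%R) by lra.
  pose proof (circle_integrable (fun z => Re (h z)) s Hs1
    (Re_continuous_on_punctured h Hh)) as Hex. cbv beta in Hex.
  replace (circle_integral (fun z => Re (h z)) s - 2 * PI * Re a)%R
    with (RInt (fun t => Re (h (s * cis t)%C) - Re a)%R 0 (2 * PI)).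
  2: { rewrite (RInt_minus (V := R_CompleteNormedModule)
         (fun t => Re (h (s * cis t))) (fun _ => Re a));
         [|exact Hex|apply ex_RInt_const].
       rewrite RInt_const. unfold circle_integral, minus, plus, opp, scal; simpl.
       unfold mult; simpl.
       match goal with |- ?a = ?b => change (a = b :> R) end. ring. }
  replace eps with ((2 * PI - 0) * (eps / (2 * PI)))%R by (field; lra).
  apply abs_RInt_le_const; [lra| |].
  - apply (ex_RInt_minus (V := R_NormedModule)
      (fun t => Re (h (s * cis t))) (fun _ => Re a));
      [exact Hex|apply ex_RInt_const].
  - intros t _. apply Rlt_le. eapply Rle_lt_trans; [|apply (H (s * cis t))].
    + replace (Re (h (s * cis t)%C) - Re a)%R with (Re (h (s * cis t) - a))
        by (unfold Re; simpl; ring).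
      apply re_le_Cmod.
    + now apply circle_punctured.
    + rewrite Cmod_circle; lra.
Qed.

(** * Mean squares and Bessel's inequality *)

Definition punctured_holomorphic (h : C -> C) (a : C) : Prop :=
  C1_on punctured_disk h /\ limit_at_0 h a.

Definition mean_square (h : C -> C) (r : R) : R :=
  circle_integral (fun z => Cmod (h z) ^ 2)%R r.

Lemma mean_square_continuous (h : C -> C) :
  C1_on punctured_disk h -> forall z, punctured_disk z ->
  @continuous CU R_UniformSpace (fun z => Cmod (h z) ^ 2)%R z.
Proof.
  intros Hh z Hz. pose proof (C1_on_ccont _ _ _ Hh Hz) as Hc.
  assert (HN : @continuous CU R_UniformSpace (fun z => Cmod (h z)) z).
  { apply (continuous_comp (U := CU) (V := CU) (W := R_UniformSpace) h Cmod).
    - exact Hc.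
    - exact (filterlim_norm (V := AbsRing_NormedModule C_AbsRing) (h z)). }
  apply (continuous_ext (T := CU) (U := R_UniformSpace))
    with (f := fun z => (Cmod (h z) * Cmod (h z))%R).
  { intros w. simpl. ring. }
  exact (continuous_mult (U := CU) (K := R_AbsRing) _ _ z HN HN).
Qed.

Lemma mean_square_integrable (h : C -> C) (r : R) :
  C1_on punctured_disk h -> (0 < r < 1)%R ->
  ex_RInt (fun t => Cmod (h (r * cis t)%C) ^ 2)%R 0 (2 * PI).
Proof.
  intros Hh Hr. apply (circle_integrable (fun z => Cmod (h z) ^ 2)%R r Hr).
  now apply mean_square_continuous.
Qed.

Lemma mean_square_ge_0 (h : C -> C) (r : R) :
  C1_on punctured_disk h -> (0 < r < 1)%R -> (0 <= mean_square h r)%R.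
Proof.
  intros Hh Hr. apply RInt_ge_0.
  - pose proof two_PI_pos. lra.
  - now apply mean_square_integrable.
  - intros t _. apply pow2_ge_0.
Qed.

(** |h|^2 = |h - a|^2 + 2 Re (conj(a) (h - a)) + |a|^2, and the cross term is the real part of a
    function tending to 0 at the origin, so its integral vanishes by the mean value property. *)
Lemma mean_square_split (h : C -> C) (a : C) (r : R) :
  punctured_holomorphic h a -> (0 < r < 1)%R ->
  mean_square h r =
    (2 * PI * Cmod a ^ 2 + mean_square (fun z => h z - a)%C r)%R.
Proof.
  intros [Hh Ha] Hr.
  set (k := fun z => Cconj a * (h z - a)).
  assert (H1 : C1_on punctured_disk (fun z => h z - a))
    by (apply C1_on_minus; [exact Hh|apply C1_on_const]).
  assert (Hk : C1_on punctured_disk k)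
    by (apply C1_on_mult; [apply C1_on_const|exact H1]).
  assert (Hk0 : limit_at_0 k 0).
  { intros eps He.
    pose proof (Cmod_ge_0 a) as Hm.
    destruct (Ha (eps / (Cmod a + 1))%R) as [d [Hd H]];
      [apply Rdiv_lt_0_compat; lra|].
    exists d. split; [exact Hd|]. intros z Hz Hzd. specialize (H z Hz Hzd).
    unfold k. replace (Cconj a * (h z - a) - 0) with (Cconj a * (h z - a)) by ring.
    rewrite Cmod_mult, Cmod_conj.
    apply Rlt_div_r in H; [|lra].
    pose proof (Cmod_ge_0 (h z - a)). nra. }
  pose proof (mean_value k 0 r Hk Hk0 Hr) as HM.
  change (Re (RtoC 0)) with 0%R in HM. rewrite Rmult_0_r in HM.
  pose proof (mean_square_integrable _ r H1 Hr) as E1. cbv beta in E1.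
  pose proof (circle_integrable (fun z => Re (k z)) r Hr
    (Re_continuous_on_punctured k Hk)) as E2. cbv beta in E2.
  unfold mean_square, circle_integral in *.
  transitivity (RInt (fun t => plus (plus (Cmod (h (r * cis t) - a)%C ^ 2)%R
    (scal 2%R (Re (k (r * cis t))))) (Cmod a ^ 2)%R) 0 (2 * PI)).
  { apply RInt_ext. intros t _. unfold k.
    generalize (h (r * cis t)). intros [x y]. destruct a as [b c].
    rewrite !Cmod2_alt. unfold plus, scal; simpl. unfold mult; simpl. ring. }
  rewrite (RInt_plus (V := R_CompleteNormedModule)); cycle 1.
  { apply (ex_RInt_plus (V := R_NormedModule)); [exact E1|].
    apply (ex_RInt_scal (V := R_NormedModule)). exact E2. }
  { apply ex_RInt_const. }
  rewrite (RInt_plus (V := R_CompleteNormedModule)); cycle 1.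
  { exact E1. }
  { apply (ex_RInt_scal (V := R_NormedModule)). exact E2. }
  rewrite (RInt_scal (V := R_CompleteNormedModule)) by exact E2.
  rewrite RInt_const, HM. unfold plus, scal; simpl. unfold mult; simpl. ring.
Qed.

Lemma bernoulli_sub (t : R) (n : nat) :
  (0 <= t <= 1)%R -> (1 - INR n * t <= (1 - t) ^ n)%R.
Proof.
  intros Ht. induction n as [|n IH]; [simpl; lra|].
  rewrite S_INR. simpl pow. pose proof (pos_INR n).
  assert (0 <= INR n * t)%R by nra. nra.
Qed.

Lemma mean_square_quotient (h g : C -> C) (r : R) :
  C1_on punctured_disk g -> (0 < r < 1)%R ->
  (forall z, punctured_disk z -> h z = z * g z) ->
  mean_square h r = (r ^ 2 * mean_square g r)%R.
Proof.
  intros Hg Hr Hh.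
  unfold mean_square, circle_integral.
  pose proof (mean_square_integrable g r Hg Hr) as E.
  transitivity (scal (r ^ 2)%R
    (RInt (fun t => Cmod (g (r * cis t)%C) ^ 2)%R 0 (2 * PI))); [|reflexivity].
  rewrite <- (RInt_scal (V := R_CompleteNormedModule)
    (fun t => Cmod (g (r * cis t)%C) ^ 2)%R 0 (2 * PI) (r ^ 2)%R E).
  apply RInt_ext. intros t _. rewrite Hh by now apply circle_punctured.
  rewrite Cmod_mult, Cmod_circle by lra.
  unfold scal; simpl. unfold mult; simpl. ring.
Qed.

Lemma punctured_neq_0 (z : C) : punctured_disk z -> z <> 0.
Proof. intros [Hz _]. now apply Cmod_gt_0. Qed.

(* Parseval's formula, one coefficient at a time: each step splits off the
   constant term and divides the remainder by [z]. *)
Lemma bessel_three (w g : C -> C) (b1 b2 b3 : C) :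
  C1_on punctured_disk w ->
  (forall z, punctured_disk z -> (Cmod (w z) <= 1)%R) ->
  @continuous CU CU g (RtoC 0) -> g 0 = b3 ->
  (forall z, punctured_disk z -> w z = z * (b1 + z * (b2 + z * g z))) ->
  (Cmod b1 ^ 2 + Cmod b2 ^ 2 + Cmod b3 ^ 2 <= 1)%R.
Proof.
  intros Hw Hw1 Hg Hg0 Hwg.
  pose proof punctured_neq_0 as Hn0.
  set (g1 := fun z => w z / z).
  set (g2 := fun z => (g1 z - b1) / z).
  set (g3 := fun z => (g2 z - b2) / z).
  assert (C1 : C1_on punctured_disk g1)
    by (apply C1_on_div; [exact Hw|apply C1_on_id|exact Hn0]).
  assert (C2 : C1_on punctured_disk g2)
    by (apply C1_on_div; [apply C1_on_minus; [exact C1|apply C1_on_const]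
                         |apply C1_on_id|exact Hn0]).
  assert (C3 : C1_on punctured_disk g3)
    by (apply C1_on_div; [apply C1_on_minus; [exact C2|apply C1_on_const]
                         |apply C1_on_id|exact Hn0]).
  assert (K : forall b k, @continuous CU CU k (RtoC 0) ->
                @continuous CU CU (fun z => b + z * k z) (RtoC 0))
    by (intros b k Hk; ccont).
  assert (E1 : forall z, punctured_disk z -> g1 z = b1 + z * (b2 + z * g z)).
  { intros z Hz. unfold g1. rewrite (Hwg z Hz). field. now apply Hn0. }
  assert (E2 : forall z, punctured_disk z -> g2 z = b2 + z * g z).
  { intros z Hz. unfold g2. rewrite (E1 z Hz). field. now apply Hn0. }
  assert (E3 : forall z, punctured_disk z -> g3 z = g z).
  { intros z Hz. unfold g3. rewrite (E2 z Hz). field. now apply Hn0. }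
  assert (P1 : punctured_holomorphic g1 b1).
  { split; [exact C1|].
    replace b1 with (b1 + 0 * (b2 + 0 * g 0)) at 1 by ring.
    apply (limit_at_0_of_ccont g1 (fun z => b1 + z * (b2 + z * g z)));
      [now apply K, K|exact E1]. }
  assert (P2 : punctured_holomorphic g2 b2).
  { split; [exact C2|].
    replace b2 with (b2 + 0 * g 0) at 1 by ring.
    apply (limit_at_0_of_ccont g2 (fun z => b2 + z * g z));
      [now apply K|exact E2]. }
  assert (P3 : punctured_holomorphic g3 b3).
  { split; [exact C3|]. rewrite <- Hg0. now apply limit_at_0_of_ccont. }
  (* Each division by z costs a factor r^2 on the circle of radius r. The mean square left after the
     third coefficient is nonnegative and is discarded. *)
  assert (Q : forall r, (0 < r < 1)%R ->
    (r ^ 2 * (Cmod b1 ^ 2 + r ^ 2 * (Cmod b2 ^ 2 + r ^ 2 * Cmod b3 ^ 2)) <= 1)%R).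
  { intros r Hr. pose proof two_PI_pos as HPI.
    assert (M0 : (mean_square w r <= 2 * PI)%R).
    { apply Rle_trans with (RInt (fun _ => 1%R) 0 (2 * PI)).
      - apply RInt_le; [lra|now apply mean_square_integrable|
                        apply ex_RInt_const|].
        intros t _. specialize (Hw1 _ (circle_punctured r t Hr)).
        pose proof (Cmod_ge_0 (w (r * cis t))). simpl. nra.
      - rewrite RInt_const. unfold scal; simpl. unfold mult; simpl. lra. }
    rewrite (mean_square_quotient w g1 r C1 Hr) in M0
      by (intros z Hz; unfold g1; field; now apply Hn0).
    rewrite (mean_square_split g1 b1 r P1 Hr) in M0.
    rewrite (mean_square_quotient (fun z => g1 z - b1) g2 r C2 Hr) in M0
      by (intros z Hz; unfold g2; field; now apply Hn0).
    rewrite (mean_square_split g2 b2 r P2 Hr) in M0.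
    rewrite (mean_square_quotient (fun z => g2 z - b2) g3 r C3 Hr) in M0
      by (intros z Hz; unfold g3; field; now apply Hn0).
    rewrite (mean_square_split g3 b3 r P3 Hr) in M0.
    assert (M3 : (0 <= mean_square (fun z => g3 z - b3)%C r)%R)
      by (apply mean_square_ge_0; [apply C1_on_minus;
            [exact C3|apply C1_on_const]|exact Hr]).
    set (m := mean_square (fun z => g3 z - b3) r) in *.
    apply Rmult_le_reg_l with (2 * PI)%R; [exact HPI|].
    assert (0 <= r ^ 2 * (r ^ 2 * (r ^ 2 * m)))%R
      by (pose proof (pow2_ge_0 r) as Hr2;
          do 3 (apply Rmult_le_pos; [exact Hr2|]); exact M3).
    lra. }
  set (x := (Cmod b1 ^ 2)%R) in *. set (y := (Cmod b2 ^ 2)%R) in *.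
  set (v := (Cmod b3 ^ 2)%R) in *.
  assert (Hx : (0 <= x)%R) by apply pow2_ge_0.
  assert (Hy : (0 <= y)%R) by apply pow2_ge_0.
  assert (Hv : (0 <= v)%R) by apply pow2_ge_0.
  apply Rnot_lt_le. intros Hlt. set (S := (x + y + v)%R) in *.
  (* The weights r^2, r^4, r^6 are all lowered to r^6, which leaves a single limit r -> 1. *)
  assert (HS : forall r, (0 < r < 1)%R -> (r ^ 6 * S <= 1)%R).
  { intros r Hr. eapply Rle_trans; [|apply (Q r Hr)].
    assert (Hr2 : (0 <= r ^ 2 <= 1)%R) by (simpl; nra).
    replace (r ^ 6)%R with (r ^ 2 * r ^ 2 * r ^ 2)%R by ring.
    set (q := (r ^ 2)%R) in *. unfold S.
    assert (q * q <= q)%R by nra. assert (q * q * q <= q * q)%R by nra.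
    assert (0 <= q * q)%R by nra. nra. }
  (* In place of the limit: at r = 1 - t Bernoulli gives r^6 S >= S - 6 t S = (S + 1) / 2, which
     exceeds 1 if S does. *)
  set (t := ((S - 1) / (12 * S))%R).
  assert (Ht : (12 * S * t = S - 1)%R) by (unfold t; field; lra).
  assert (Ht0 : (0 < t)%R) by (apply Rdiv_lt_0_compat; lra).
  assert (Ht1 : (t < 1)%R) by nra.
  assert (Hr : (0 < 1 - t < 1)%R) by lra.
  specialize (HS (1 - t)%R Hr).
  pose proof (bernoulli_sub t 6 (conj (Rlt_le _ _ Ht0) (Rlt_le _ _ Ht1))) as HB.
  simpl INR in HB. nra.
Qed.

(** * Third-order expansions at the origin *)

(** A Taylor expansion with error o(z^3): the last coefficient is the value at 0 of a remainder
    factor that need only be continuous there. In this form expansions can be multiplied, divided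
    and exponentiated without any power series for the result. *)
Definition jet (h : C -> C) (a0 a1 a2 a3 : C) : Prop :=
  exists g : C -> C, @continuous CU CU g (RtoC 0) /\ g 0 = a3 /\
    forall z, in_disk z -> h z = a0 + z * (a1 + z * (a2 + z * g z)).

Lemma jet_eq (h : C -> C) (a0 a1 a2 a3 b0 b1 b2 b3 : C) :
  a0 = b0 -> a1 = b1 -> a2 = b2 -> a3 = b3 ->
  jet h a0 a1 a2 a3 -> jet h b0 b1 b2 b3.
Proof. now intros <- <- <- <-. Qed.

Lemma jet_const (c : C) : jet (fun _ => c) c 0 0 0.
Proof.
  exists (fun _ => 0). split; [ccont|split; [reflexivity|]]. intros z _. ring.
Qed.

Lemma jet_id : jet (fun z => z) 0 1 0 0.
Proof.
  exists (fun _ => 0). split; [ccont|split; [reflexivity|]]. intros z _. ring.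
Qed.

Lemma jet_plus (f h : C -> C) (a0 a1 a2 a3 b0 b1 b2 b3 : C) :
  jet f a0 a1 a2 a3 -> jet h b0 b1 b2 b3 ->
  jet (fun z => f z + h z) (a0 + b0) (a1 + b1) (a2 + b2) (a3 + b3).
Proof.
  intros [p [Hp [Ep Hf]]] [q [Hq [Eq Hh]]].
  exists (fun z => p z + q z). split; [ccont|split; [congruence|]].
  intros z Hz. rewrite (Hf z Hz), (Hh z Hz). ring.
Qed.

Lemma jet_mult (f h : C -> C) (a0 a1 a2 a3 b0 b1 b2 b3 : C) :
  jet f a0 a1 a2 a3 -> jet h b0 b1 b2 b3 ->
  jet (fun z => f z * h z) (a0 * b0) (a0 * b1 + a1 * b0)
    (a0 * b2 + a1 * b1 + a2 * b0) (a0 * b3 + a1 * b2 + a2 * b1 + a3 * b0).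
Proof.
  intros [p [Hp [Ep Hf]]] [q [Hq [Eq Hh]]].
  (* The part of the product of order at least 3, divided by z^3. *)
  exists (fun z => a0 * q z + a1 * b2 + a2 * b1 + p z * b0 +
    z * (a1 * q z + a2 * b2 + p z * b1 + z * (a2 * q z + p z * b2 + z * p z * q z))).
  split; [ccont|split].
  - rewrite Ep, Eq. ring.
  - intros z Hz. rewrite (Hf z Hz), (Hh z Hz). ring.
Qed.

Lemma jet_scal (c : C) (f : C -> C) (a0 a1 a2 a3 : C) :
  jet f a0 a1 a2 a3 ->
  jet (fun z => c * f z) (c * a0) (c * a1) (c * a2) (c * a3).
Proof.
  intros Hf. eapply jet_eq; [| | | |apply jet_mult; [apply jet_const|exact Hf]];
    ring.
Qed.

Lemma jet_reflect (f : C -> C) (a0 a1 a2 a3 : C) :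
  jet f a0 a1 a2 a3 -> jet (fun z => f (- z)) a0 (- a1) a2 (- a3).
Proof.
  intros [p [Hp [Ep Hf]]]. exists (fun z => - p (- z)). split; [|split].
  - ccont. apply (@ccont_comp CU (fun z => - z) p); [ccont|].
    now replace (- RtoC 0) with (RtoC 0) by ring.
  - replace (- RtoC 0) with (RtoC 0) by ring. now rewrite Ep.
  - intros z Hz. rewrite Hf; [ring|]. unfold in_disk. now rewrite Cmod_opp.
Qed.

Lemma Cexp_remainder :
  exists e : C -> C, @continuous CU CU e (RtoC 0) /\ e 0 = 1 / 6 /\
    forall w, Cexp w = 1 + w * (1 + w * (1 / 2 + w * e w)).
Proof.
  set (e := fun w => if Ceq_dec w 0 then 1 / 6
    else (Cexp w - (1 + w * (1 + w * (1 / 2)))) / (w * w * w)).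
  assert (E0 : e 0 = 1 / 6) by (unfold e; destruct (Ceq_dec 0 0); congruence).
  exists e. split; [|split; [exact E0|]].
  - apply ccont_eps. intros eps He.
    (* [Cexp_taylor] gives |e(w) - 1/6| <= |w|^4 / |w|^3 = |w| for |w| <= 1. *)
    exists (Rmin eps 1). split; [apply Rmin_glb_lt; lra|].
    intros w Hw. rewrite E0. replace (w - 0) with w in Hw by ring.
    pose proof (Rlt_le_trans _ _ _ Hw (Rmin_l _ _)) as H1.
    pose proof (Rlt_le_trans _ _ _ Hw (Rmin_r _ _)) as H2.
    unfold e. destruct (Ceq_dec w 0) as [E|Hn].
    { replace (1 / 6 - 1 / 6) with (RtoC 0) by field. now rewrite Cmod_0. }
    replace ((Cexp w - (1 + w * (1 + w * (1 / 2)))) / (w * w * w) - 1 / 6)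
      with ((Cexp w - (1 + w * (1 + w * (1 / 2 + w * (1 / 6))))) / (w ^ 3))
      by (simpl; field; exact Hn).
    pose proof (proj1 (Cmod_gt_0 w) Hn) as Hp.
    rewrite Cmod_div, Cmod_pow by now apply Cpow_nz.
    apply Rlt_div_l; [now apply pow_lt|].
    eapply Rle_lt_trans; [apply Cexp_taylor; lra|].
    replace (Cmod w ^ 4)%R with (Cmod w * Cmod w ^ 3)%R by ring.
    apply Rmult_lt_compat_r; [now apply pow_lt|exact H1].
  - intros w. unfold e. destruct (Ceq_dec w 0) as [->|Hn].
    + rewrite Cexp_0. ring.
    + field. exact Hn.
Qed.

Lemma jet_Cexp (f : C -> C) (a1 a2 a3 : C) :
  jet f 0 a1 a2 a3 ->
  jet (fun z => Cexp (f z)) 1 a1 (a2 + a1 * a1 / 2)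
    (a3 + a1 * a2 + a1 * a1 * a1 / 6).
Proof.
  intros [g [Hg [Eg Hf]]]. destruct Cexp_remainder as [e [He [Ee HE]]].
  set (m := fun z => a2 + z * g z). set (k := fun z => a1 + z * m z).
  assert (Hm : @continuous CU CU m (RtoC 0)) by (unfold m; ccont).
  assert (Hk : @continuous CU CU k (RtoC 0)) by (unfold k; ccont).
  (* With f = z k and k = a1 + z m, these are the z^3 parts of f, f^2 / 2 and f^3 e(f). *)
  exists (fun z => g z + (2 * a1 * m z + z * (m z * m z)) / 2
                   + k z * k z * k z * e (z * k z)).
  split; [|split].
  - ccont.
    + intros E. apply RtoC_inj in E. lra.
    + apply (@ccont_comp CU (fun z => z * k z) e); [ccont|].
      now replace (0 * k 0) with (RtoC 0) by ring.
  - replace (0 * k 0) with (RtoC 0) by ring. unfold k, m. rewrite Ee, Eg. field.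
  - intros z Hz. rewrite (Hf z Hz).
    replace (0 + z * (a1 + z * (a2 + z * g z))) with (z * k z)
      by (unfold k, m; ring).
    rewrite (HE (z * k z)). generalize (e (z * k z)). intros c.
    unfold k, m. field.
Qed.

(** The coefficients of the quotient are proposed rather than computed: the expansion assumed of [f]
    is the Cauchy product of those of [h] and the proposed quotient. *)
Lemma jet_div (f h : C -> C) (a0 a1 a2 a3 b0 b1 b2 b3 : C) :
  a0 <> 0 -> (forall z, in_disk z -> h z <> 0) ->
  jet h a0 a1 a2 a3 ->
  jet f (a0 * b0) (a0 * b1 + a1 * b0) (a0 * b2 + a1 * b1 + a2 * b0)
    (a0 * b3 + a1 * b2 + a2 * b1 + a3 * b0) ->
  jet (fun z => f z / h z) b0 b1 b2 b3.
Proof.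
  intros Ha0 Hh0 [p [Hp [Ep Hh]]] [q [Hq [Eq Hf]]].
  exists (fun z => (q z - (a1 * b2 + a2 * b1 + p z * b0 +
     z * (a2 * b2 + p z * b1 + z * (p z * b2)))) /
     (a0 + z * (a1 + z * (a2 + z * p z)))).
  assert (E0 : a0 + 0 * (a1 + 0 * (a2 + 0 * p 0)) = a0) by ring.
  split; [|split].
  - ccont. now rewrite E0.
  - rewrite E0, Ep, Eq. field. exact Ha0.
  - intros z Hz. pose proof (Hh0 z Hz) as Hn. rewrite (Hh z Hz) in *.
    rewrite (Hf z Hz). field. exact Hn.
Qed.

Lemma jet_power_series (a : nat -> C) (f : C -> C) :
  power_series_on_disk a f -> jet f (a 0%nat) (a 1%nat) (a 2%nat) (a 3%nat).
Proof.
  intros Hf.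
  destruct (power_series_tail _ _ Hf) as [f1 [H1 E1]].
  destruct (power_series_tail _ _ H1) as [f2 [H2 E2]].
  destruct (power_series_tail _ _ H2) as [f3 [H3 E3]].
  exists f3. split; [|split].
  - destruct (power_series_derive _ _ H3) as [f3' [_ D3]].
    apply (cdiff_ccont f3 0 (f3' 0)), D3. unfold in_disk. rewrite Cmod_0. lra.
  - exact (power_series_at_0 _ _ H3).
  - intros z Hz. now rewrite (E1 z Hz), (E2 z Hz), (E3 z Hz).
Qed.

Lemma power_series_C1 (a : nat -> C) (f f' : C -> C) :
  power_series_on_disk a f' ->
  (forall z, in_disk z -> cdiff f z (f' z)) -> C1_on in_disk f.
Proof.
  intros Hf' Hd. destruct (power_series_derive _ _ Hf') as [f'' [_ Hf'']].
  exists f'. intros z Hz. split; [now apply Hd|].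
  exact (cdiff_ccont _ _ _ (Hf'' z Hz)).
Qed.

Lemma C1_on_Cexp (U : C -> Prop) (f : C -> C) :
  C1_on U f -> C1_on U (fun z => Cexp (f z)).
Proof.
  intros HF. pose proof HF as [f' Hf].
  exists (fun z => Cexp (f z) * f' z). intros z Hz. destruct (Hf z Hz) as [H1 H2].
  split.
  - apply cdiff_comp; [exact H1|apply Cexp_cdiff].
  - ccont. apply (@ccont_comp CU f Cexp).
    + exact (cdiff_ccont _ _ _ H1).
    + exact (cdiff_ccont _ _ _ (Cexp_cdiff (f z))).
Qed.

Lemma C1_on_reflect (f : C -> C) :
  C1_on in_disk f -> C1_on in_disk (fun z => f (- z)).
Proof.
  intros [f' Hf].
  exists (fun z => f' (- z) * - (1)). intros z Hz.
  assert (Hz' : in_disk (- z)) by (unfold in_disk; now rewrite Cmod_opp).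
  destruct (Hf _ Hz') as [H1 H2]. split.
  - apply cdiff_comp with (f := fun w => - w); [|exact H1].
    apply cdiff_ext_loc with (fun w => - (1) * w).
    { apply filter_forall. intros w. change (- (1) * w = - w). ring. }
    eapply cdiff_eq; [|apply cdiff_mult; [apply cdiff_const|apply cdiff_id]].
    cbv beta. ring.
  - ccont. apply (@ccont_comp CU (fun z => - z) f'); [ccont|exact H2].
Qed.

(** With p = u / (2 v) the quotient is the Cayley transform (2 p - 1) / (2 p + 1), and |2 p + 1|^2 -
    |2 p - 1|^2 = 8 Re p. *)
Lemma cayley_bound (u v : C) :
  v <> 0 -> (0 < Re (u / (2 * v)))%R ->
  u + v <> 0 /\ (Cmod ((u - v) / (u + v)) <= 1)%R.
Proof.
  intros Hv Hre.
  set (p := u / (2 * v)) in *.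
  assert (Hu : u = 2 * p * v) by (unfold p; field; exact Hv).
  clearbody p.
  assert (Hp : 2 * p + 1 <> 0).
  { intros E. apply (f_equal Re) in E. unfold Re in *. simpl in E. lra. }
  assert (Huv : u + v <> 0).
  { rewrite Hu. replace (2 * p * v + v) with ((2 * p + 1) * v) by ring.
    now apply Cmult_neq_0. }
  split; [exact Huv|].
  replace ((u - v) / (u + v)) with ((2 * p - 1) / (2 * p + 1)).
  2: { rewrite Hu in *. field. auto. }
  rewrite Cmod_div by exact Hp.
  apply Rle_div_l; [now apply Cmod_gt_0|]. rewrite Rmult_1_l.
  apply Rsqr_incr_0; [|apply Cmod_ge_0|apply Cmod_ge_0].
  rewrite !Rsqr_pow2, !Cmod2_alt.
  destruct p as [x y]. unfold Re, Im in *. simpl in *. nra.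
Qed.

(** For the moduli x, y, w of b1, b2, b3, use x w <= (x^2 + w^2) / 2, y <= 1 and x^4 <= x^2. The
    total is at most (5/3) x^2 + 2 y^2 + w^2 / 2. *)
Lemma hankel_from_schwarz_coefficients (b1 b2 b3 : C) :
  (Cmod b1 ^ 2 + Cmod b2 ^ 2 + Cmod b3 ^ 2 <= 1)%R ->
  (Cmod (b1 * b3 - b1 * b1 * b2 + b1 * b1 * b1 * b1 / 6 - 2 * (b2 * b2)) <= 2)%R.
Proof.
  intros H.
  unfold Cminus. eapply Rle_trans; [apply Cmod_triangle|].
  eapply Rle_trans; [apply Rplus_le_compat_r, Cmod_triangle|].
  eapply Rle_trans; [apply Rplus_le_compat_r, Rplus_le_compat_r, Cmod_triangle|].
  assert (H6 : Cmod (b1 * b1 * b1 * b1 / 6) = (Cmod b1 ^ 4 / 6)%R).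
  { unfold Cdiv. rewrite <- RtoC_inv by lra.
    rewrite !Cmod_mult, Cmod_R, Rabs_pos_eq by lra. field. }
  rewrite !Cmod_opp, H6, !Cmod_mult, Cmod_R, Rabs_pos_eq by lra.
  pose proof (Cmod_ge_0 b1) as Hx. pose proof (Cmod_ge_0 b2) as Hy.
  pose proof (Cmod_ge_0 b3) as Hw.
  set (x := Cmod b1) in *. set (y := Cmod b2) in *. set (w := Cmod b3) in *.
  assert (H1 : (x * w <= (x ^ 2 + w ^ 2) / 2)%R)
    by (pose proof (pow2_ge_0 (x - w)); simpl in *; lra).
  assert (Hx2 : (0 <= x ^ 2)%R) by apply pow2_ge_0.
  assert (Hw2 : (0 <= w ^ 2)%R) by apply pow2_ge_0.
  assert (Hy2 : (0 <= y ^ 2)%R) by apply pow2_ge_0.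
  assert (Hy1 : (y <= 1)%R) by nra.
  assert (H2 : (x * x * y <= x ^ 2)%R) by nra.
  assert (H3 : (x ^ 4 <= x ^ 2)%R).
  { replace (x ^ 4)%R with (x ^ 2 * x ^ 2)%R by ring. nra. }
  simpl in *. lra.
Qed.

(** * The bound and the extremal function *)

Lemma in_disk_0 : in_disk 0.
Proof. unfold in_disk. rewrite Cmod_0. lra. Qed.

Lemma in_disk_opp (z : C) : in_disk z -> in_disk (- z).
Proof. unfold in_disk. now rewrite Cmod_opp. Qed.

Lemma in_disk_open (z : C) : in_disk z -> locally (T := CU) z in_disk.
Proof.
  intros Hz. assert (Hd : (0 < 1 - Cmod z)%R) by (unfold in_disk in Hz; lra).
  exists (mkposreal _ Hd). intros w Hw.
  change (Cmod (w - z) < 1 - Cmod z)%R in Hw. change (Cmod w < 1)%R.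
  pose proof (Cmod_triangle_rev w z). lra.
Qed.

Lemma C_derive_cdiff (f : C -> C) (z l : C) : cdiff f z l -> C_derive f z = l.
Proof. intros H. now apply is_C_derive_unique, cdiff_is_derive. Qed.

(** The series of F starts at index 1; the coefficient 0 at index 0 encodes F(0) = 0, whatever
    [gamma 0] is. *)
Definition log_series_coefficients (gamma : nat -> C) (n : nat) : C :=
  match n with O => 0 | S _ => 2 * gamma n end.

Lemma log_series_power_series (gamma : nat -> C) (F : C -> C) :
  power_series_on_disk (log_series_coefficients gamma) F <->
  (forall z, in_disk z -> cseries (fun n => 2 * (gamma (S n) * z ^ S n)) (F z)).
Proof.
  assert (E : forall z n, log_series_coefficients gamma (S n) * z ^ S n =
                          2 * (gamma (S n) * z ^ S n)) by (intros; simpl; ring).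
  assert (E0 : forall z : C, F z - log_series_coefficients gamma 0 * z ^ 0 = F z)
    by (intros; simpl; ring).
  split; intros H z Hz; specialize (H z Hz).
  - apply (fun H => proj1 (cseries_shift _ _) H) in H. cbv beta in H.
    rewrite E0 in H. revert H. apply cseries_ext. apply E.
  - apply cseries_shift. rewrite E0. revert H. apply cseries_ext.
    intros n. symmetry. apply E.
Qed.

Lemma hankel_bound (f : C -> C) (gamma : nat -> C) :
  starlike_symmetric f -> log_coefficients f gamma ->
  (Cmod (hankel_2_1 gamma) <= 1 / 4)%R.
Proof.
  intros [[_ [f0 _]] Hstar] [F [[_ [_ HF]] Hser]].
  apply log_series_power_series in Hser.
  set (g1 := gamma 1%nat). set (g2 := gamma 2%nat). set (g3 := gamma 3%nat).
  pose proof (jet_power_series _ _ Hser) as JF.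
  destruct (power_series_derive _ _ Hser) as [F' [HF' DF]].
  pose proof (jet_power_series _ _ HF') as JF'.
  assert (CF : C1_on in_disk F) by exact (power_series_C1 _ _ _ HF' DF).
  (* [u] contains F', so its derivative contains F'' and a second termwise differentiation is
     needed. *)
  assert (CF' : C1_on in_disk F').
  { destruct (power_series_derive _ _ HF') as [F'' [HF'' DF']].
    exact (power_series_C1 _ _ _ HF'' DF'). }
  assert (Hf : forall z, in_disk z -> f z = z * Cexp (F z)).
  { intros z Hz. rewrite (HF z Hz). unfold quotient_by_id.
    destruct (Ceq_dec z 0) as [->|Hn]; [rewrite f0; ring|]. field. exact Hn. }
  assert (Hf' : forall z, in_disk z ->
            C_derive f z = Cexp (F z) * (1 + z * F' z)).
  { intros z Hz. apply C_derive_cdiff.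
    apply cdiff_ext_loc with (fun w => w * Cexp (F w)).
    { generalize (in_disk_open z Hz). apply filter_imp. intros w Hw.
      symmetry. now apply Hf. }
    eapply cdiff_eq; [|apply cdiff_mult; [apply cdiff_id|
      apply (cdiff_comp F Cexp); [apply DF, Hz|apply Cexp_cdiff]]].
    cbv beta. ring. }
  (* Off the origin [u] is z f'(z) / f(z) and [v] is (f(z) - f(-z)) / (2 f(z)); the factor 1/2 makes
     both equal to 1 at 0. Differences are written with [- (1) *] to fit [jet_plus] and
     [jet_scal]. *)
  set (u := fun z => 1 + z * F' z).
  set (v := fun z => 1 / 2 * (1 + Cexp (F (- z) + - (1) * F z))).
  assert (HE : forall z, Cexp (F z) * Cexp (F (- z) + - (1) * F z) = Cexp (F (- z))).
  { intros z. rewrite <- Cexp_plus. f_equal. ring. }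
  assert (Hsplit : forall z, in_disk z ->
            f z - f (- z) = z * Cexp (F z) * (2 * v z)).
  { intros z Hz. rewrite (Hf z Hz), (Hf _ (in_disk_opp z Hz)), <- (HE z).
    unfold v. field. }
  assert (Hbound : forall z, in_disk z -> z <> 0 ->
            u z + v z <> 0 /\ (Cmod ((u z - v z) / (u z + v z)) <= 1)%R).
  { intros z Hz Hn. destruct (Hstar z Hz) as [Hne Hre].
    pose proof (Hsplit z Hz) as Hs. pose proof (Cexp_neq_0 (F z)) as He.
    assert (Hv : v z <> 0).
    { intros E. apply (Hne Hn). rewrite E in Hs.
      replace (f z) with (f z - f (- z) + f (- z)) by ring. rewrite Hs. ring. }
    apply cayley_bound; [exact Hv|].
    unfold symmetric_quotient in Hre.
    destruct (Ceq_dec z 0) as [E|_]; [contradiction|].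
    rewrite Hs, (Hf' z Hz) in Hre. fold (u z) in Hre.
    replace (u z / (2 * v z))
      with (z * (Cexp (F z) * u z) / (z * Cexp (F z) * (2 * v z))).
    - exact Hre.
    - field. repeat split; assumption. }
  (* At the origin the starlikeness condition only sees the prescribed value 1/2, so u(0) + v(0) = 2
     is computed directly. *)
  assert (Hsum : forall z, in_disk z -> u z + v z <> 0).
  { intros z Hz. destruct (Ceq_dec z 0) as [->|Hn]; [|now apply Hbound].
    unfold u, v. replace (- RtoC 0) with (RtoC 0) by ring.
    replace (F 0 + - (1) * F 0) with (RtoC 0) by ring. rewrite Cexp_0.
    replace (1 + 0 * F' 0 + 1 / 2 * (1 + 1)) with (RtoC 2) by field.
    intros E. apply RtoC_inj in E. lra. }
  set (b1 := 2 * g1). set (b2 := 2 * g2 - 2 * (g1 * g1)).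
  set (b3 := 4 * g3 - 4 * (g1 * g2) - 4 / 3 * (g1 * g1 * g1)).
  assert (Ju : jet u 1 (2 * g1) (4 * g2) (6 * g3)).
  { eapply jet_eq; [| | | |apply jet_plus;
      [apply jet_const|apply jet_mult; [apply jet_id|exact JF']]];
    unfold log_series_coefficients, g1, g2, g3; simpl INR;
      rewrite ?RtoC_plus; ring. }
  (* The exponent F(-z) - F(z) is odd, which is why [g2] does not occur. *)
  assert (Jv : jet v 1 (- (2) * g1) (4 * (g1 * g1))
                 (- (2) * g3 - 16 / 3 * (g1 * g1 * g1))).
  { eapply jet_eq; [| | | |apply jet_scal, jet_plus; [apply jet_const|
      apply jet_Cexp; eapply jet_eq; [| | | |apply jet_plus;
        [apply (jet_reflect F); exact JF|apply jet_scal; exact JF]]]];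
      try reflexivity;
    unfold log_series_coefficients, g1, g2, g3; field. }
  (* The linear terms of [u] and [v] are opposite, so u + v = 2 + O(z^2): b1 and b2 are half the
     coefficients of u - v, and only b3 gets a correction. *)
  assert (Jw : jet (fun z => (u z + - (1) * v z) / (u z + v z)) 0 b1 b2 b3).
  { eapply (jet_div (fun z => u z + - (1) * v z) (fun z => u z + v z));
      [|exact Hsum|apply jet_plus; [exact Ju|exact Jv]|].
    - intros E. replace (RtoC 1 + 1) with (RtoC 2) in E by ring.
      apply RtoC_inj in E. lra.
    - eapply jet_eq; [| | | |apply jet_plus; [exact Ju|apply jet_scal; exact Jv]];
        unfold b1, b2, b3; field. }
  assert (Cu : C1_on in_disk u)
    by (apply C1_on_plus; [apply C1_on_const|
          apply C1_on_mult; [apply C1_on_id|exact CF']]).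
  assert (Cv : C1_on in_disk v).
  { apply C1_on_mult; [apply C1_on_const|].
    apply C1_on_plus; [apply C1_on_const|].
    apply (C1_on_Cexp in_disk (fun z => F (- z) + - (1) * F z)).
    apply C1_on_plus; [now apply C1_on_reflect|].
    apply C1_on_mult; [apply C1_on_const|exact CF]. }
  assert (Cw : C1_on punctured_disk (fun z => (u z + - (1) * v z) / (u z + v z))).
  { apply C1_on_sub with in_disk; [intros z Hz; apply Hz|].
    apply C1_on_div; [|now apply C1_on_plus|exact Hsum].
    apply C1_on_plus; [exact Cu|]. apply C1_on_mult; [apply C1_on_const|exact Cv]. }
  destruct Jw as [g [Hg [Eg Hw]]].
  assert (HB : (Cmod b1 ^ 2 + Cmod b2 ^ 2 + Cmod b3 ^ 2 <= 1)%R).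
  { apply (bessel_three _ g b1 b2 b3 Cw); [|exact Hg|exact Eg|].
    - intros z Hz. replace (u z + - (1) * v z) with (u z - v z) by ring.
      apply Hbound; [apply Hz|now apply punctured_neq_0].
    - intros z Hz. rewrite (Hw z (proj2 Hz)). ring. }
  pose proof (hankel_from_schwarz_coefficients b1 b2 b3 HB) as HH.
  replace (b1 * b3 - b1 * b1 * b2 + b1 * b1 * b1 * b1 / 6 - 2 * (b2 * b2))
    with (8 * hankel_2_1 gamma) in HH.
  2: { unfold hankel_2_1, det2. fold g1 g2 g3. unfold b1, b2, b3. field. }
  rewrite Cmod_mult, Cmod_R, Rabs_pos_eq in HH by lra. lra.
Qed.

(** * The extremal function z / (1 - z^2) *)

Definition extremal_function (z : C) : C := z / (1 - z * z).

(* The value at [0] is the junk [/ 0]; only positive indices matter. *)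
Definition extremal_gamma (n : nat) : C :=
  if Nat.even n then / INR n else 0.

Lemma one_sub_square_neq_0 (z : C) : in_disk z -> 1 - z * z <> 0.
Proof.
  intros Hz E. unfold in_disk in Hz.
  assert (H : z * z = 1) by (replace (z * z) with (1 - (1 - z * z)) by ring;
                             rewrite E; ring).
  apply (f_equal Cmod) in H. rewrite Cmod_mult, Cmod_1 in H.
  pose proof (Cmod_ge_0 z). nra.
Qed.

Lemma extremal_cdiff (z : C) :
  in_disk z ->
  cdiff extremal_function z ((1 + z * z) / ((1 - z * z) * (1 - z * z))).
Proof.
  intros Hz. pose proof (one_sub_square_neq_0 z Hz) as Hn.
  apply cdiff_ext_loc with (fun w => w / (1 + - (1) * (w * w))).
  { apply filter_forall. intros w. unfold extremal_function.
    replace (1 - w * w) with (1 + - (1) * (w * w)) by ring. reflexivity. }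
  assert (E : 1 + - (1) * (z * z) = 1 - z * z) by ring.
  eapply cdiff_eq; [|apply (cdiff_div (fun w => w) (fun w => 1 + - (1) * (w * w)));
    [apply cdiff_id|apply cdiff_plus; [apply cdiff_const|
     apply cdiff_mult; [apply cdiff_const|
     apply cdiff_mult; apply cdiff_id]]|]].
  - cbv beta. rewrite E. field. exact Hn.
  - now rewrite E.
Qed.

(** The symmetric quotient is (1 + z^2) / (2 (1 - z^2)). Multiplying by the conjugate of the
    denominator shows its real part to be a positive multiple of 1 - |z|^4. *)
Lemma extremal_starlike : starlike_symmetric extremal_function.
Proof.
  split.
  - split; [|split].
    + intros z Hz. eexists. now apply cdiff_is_derive, extremal_cdiff.
    + unfold extremal_function. unfold Cdiv. ring.
    + rewrite (C_derive_cdiff _ _ _ (extremal_cdiff 0 in_disk_0)).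
      replace (1 - 0 * 0) with (RtoC 1) by ring. field.
  - intros z Hz. pose proof (one_sub_square_neq_0 z Hz) as Hn.
    assert (Hodd : extremal_function z - extremal_function (- z) =
                   2 * z / (1 - z * z)).
    { unfold extremal_function. replace (- z * - z) with (z * z) by ring.
      field. exact Hn. }
    assert (H2 : RtoC 2 <> 0) by (intros E; apply RtoC_inj in E; lra).
    split.
    + intros Hz0 E. rewrite E in Hodd.
      apply Hz0. replace z with (2 * z / (1 - z * z) * ((1 - z * z) / 2))
        by (field; auto).
      rewrite <- Hodd. ring.
    + unfold symmetric_quotient. destruct (Ceq_dec z 0) as [->|Hz0].
      { rewrite <- RtoC_div by lra. simpl. lra. }
      rewrite (C_derive_cdiff _ _ _ (extremal_cdiff z Hz)), Hodd.
      replace (z * ((1 + z * z) / ((1 - z * z) * (1 - z * z))) /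
               (2 * z / (1 - z * z)))
        with (RtoC (/ 2 * / Cmod (1 - z * z) ^ 2) *
              ((1 + z * z) * Cconj (1 - z * z))).
      * rewrite re_scal_l.
        pose proof (proj1 (Cmod_gt_0 _) Hn) as Hm.
        apply Rmult_lt_0_compat.
        { apply Rmult_lt_0_compat; [lra|]. apply Rinv_0_lt_compat.
          now apply pow_lt. }
        assert (Hz2 : (Cmod z ^ 2 < 1)%R).
        { unfold in_disk in Hz. pose proof (Cmod_ge_0 z). simpl. nra. }
        rewrite Cmod2_alt in Hz2. destruct z as [x y].
        unfold Re, Im in *. simpl in *. nra.
      * assert (Hc : Cconj (1 - z * z) <> 0).
        { intros E. apply Hn. apply Cmod_eq_0.
          rewrite <- Cmod_conj, E. apply Cmod_0. }
        rewrite RtoC_mult, RtoC_inv, RtoC_inv, Cmod2_conj.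
        { field. auto. }
        { apply pow_nonzero. apply Rgt_not_eq. now apply Cmod_gt_0. }
        { lra. }
Qed.

(** Here F = -log (1 - z^2) = sum of z^(2k) / k, that is 2 sum of z^n / n over even n >= 2. Without
    invoking a logarithm, F is defined by this series; from F' (1 - z^2) = 2 z the product exp(F) (1
    - z^2) has zero derivative, hence equals 1. *)
Lemma extremal_log_coefficients :
  log_coefficients extremal_function extremal_gamma.
Proof.
  set (a := log_series_coefficients extremal_gamma).
  assert (Ha : forall n, (Cmod (a n) <= 2)%R).
  { intros [|n]; [simpl; rewrite Cmod_0; lra|].
    unfold a, log_series_coefficients, extremal_gamma.
    rewrite Cmod_mult, Cmod_R, Rabs_pos_eq by lra.
    destruct (Nat.even (S n)).
    - rewrite <- RtoC_inv by (apply not_0_INR; lia).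
      assert (H1 : (1 <= INR (S n))%R) by (rewrite S_INR; pose proof (pos_INR n); lra).
      rewrite Cmod_R, Rabs_pos_eq by (apply Rlt_le, Rinv_0_lt_compat; lra).
      assert (/ INR (S n) <= / 1)%R by (apply Rinv_le_contravar; lra). lra.
    - rewrite Cmod_0. lra. }
  set (F := fun z => Csum (fun n => a n * z ^ n)).
  assert (HF : power_series_on_disk a F).
  { intros z Hz. apply Csum_correct.
    apply (ex_series_le (V := C_CompleteNormedModule))
      with (fun n => 2 * Cmod z ^ n)%R.
    - intros n. change (Cmod (a n * z ^ n) <= 2 * Cmod z ^ n)%R.
      rewrite Cmod_mult, Cmod_pow. apply Rmult_le_compat_r; [|apply Ha].
      apply pow_le, Cmod_ge_0.
    - apply (ex_series_scal (V := R_NormedModule) 2%R).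
      apply ex_series_geom. rewrite Rabs_pos_eq; [exact Hz|apply Cmod_ge_0]. }
  destruct (power_series_derive a F HF) as [F' [HF' DF]].
  assert (Ec : forall n, INR (S n) * a (S n) = if Nat.even (S n) then 2 else 0).
  { intros n. unfold a, log_series_coefficients, extremal_gamma.
    destruct (Nat.even (S n)); [|ring]. field.
    intros E. apply RtoC_inj in E. revert E. apply not_0_INR. lia. }
  (* The coefficients 0, 2, 0, 2, ... of F' have period 2, so multiplication by z^2 removes exactly
     the first two terms, 0 and 2 z. *)
  assert (F'eq : forall z, in_disk z -> F' z * (1 - z * z) = 2 * z).
  { intros z Hz.
    pose proof (cseries_scal (z * z) _ _ (HF' z Hz)) as S1.
    pose proof (proj1 (cseries_shift _ _) (proj1 (cseries_shift _ _) (HF' z Hz))) as S2.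
    cbv beta in S2. rewrite !Ec in S2. simpl Nat.even in S2. cbv iota in S2.
    assert (E : z * z * F' z = F' z - 0 * z ^ 0 - 2 * z ^ 1).
    { eapply cseries_unique; [exact S1|]. revert S2. apply cseries_ext.
      intros n. rewrite !Ec. change (Nat.even (S (S (S n)))) with (Nat.even (S n)).
      simpl. ring. }
    simpl in E. replace (F' z * (1 - z * z)) with (F' z - z * z * F' z) by ring.
    rewrite E. ring. }
  assert (F0 : F 0 = 0) by exact (power_series_at_0 a F HF).
  assert (HE : forall z, in_disk z -> Cexp (F z) * (1 + - (1) * (z * z)) = 1).
  { intros z Hz.
    rewrite (cdiff_zero_constant (fun z => Cexp (F z) * (1 + - (1) * (z * z))));
      [|clear z Hz; intros z Hz|exact Hz].
    - rewrite F0, Cexp_0. ring.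
    - eapply cdiff_eq; [|apply cdiff_mult;
        [apply (cdiff_comp F Cexp); [apply DF, Hz|apply Cexp_cdiff]|
         apply cdiff_plus; [apply cdiff_const|apply cdiff_mult;
           [apply cdiff_const|apply cdiff_mult; apply cdiff_id]]]].
      cbv beta.
      transitivity (Cexp (F z) * (F' z * (1 - z * z) - 2 * z)); [ring|].
      rewrite (F'eq z Hz). ring. }
  exists F. split; [split; [|split]|].
  - intros z Hz. eexists. apply cdiff_is_derive. now apply DF.
  - exact F0.
  - intros z Hz. pose proof (one_sub_square_neq_0 z Hz) as Hn.
    assert (E : Cexp (F z) = 1 / (1 - z * z)).
    { replace (Cexp (F z))
        with (Cexp (F z) * (1 + - (1) * (z * z)) / (1 - z * z))
        by (field; exact Hn).
      now rewrite (HE z Hz). }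
    rewrite E. unfold quotient_by_id, extremal_function.
    destruct (Ceq_dec z 0) as [->|Hz0].
    + replace (1 - 0 * 0) with (RtoC 1) by ring. field.
    + field. auto.
  - exact (proj1 (log_series_power_series _ _) HF).
Qed.

Theorem theorem2p2 :
  (forall (f : C -> C) (gamma : nat -> C),
      starlike_symmetric f ->
      log_coefficients f gamma ->
      (Cmod (hankel_2_1 gamma) <= 1 / 4)%R) /\
  (exists (f : C -> C) (gamma : nat -> C),
      starlike_symmetric f /\
      log_coefficients f gamma /\
      Cmod (hankel_2_1 gamma) = (1 / 4)%R).
Proof.
  split; [exact hankel_bound|].
  exists extremal_function, extremal_gamma.
  split; [exact extremal_starlike|split; [exact extremal_log_coefficients|]].
  (* gamma_1 = gamma_3 = 0 and gamma_2 = 1/2. *)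
  replace (hankel_2_1 extremal_gamma) with (RtoC (- (1 / 4))).
  - rewrite Cmod_R, Rabs_Ropp, Rabs_pos_eq; lra.
  - unfold hankel_2_1, det2, extremal_gamma. simpl Nat.even. cbv iota.
    apply injective_projections; simpl; field.
Qed.
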